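(* For every integer $m\ge 1$, the zeros of $P_{mp-1}(x)$ are exactly the following points: (i) the $p-1$ Dirichlet data points $\{x_j\}_{j=1}^{p-1}$; (ii) the $(m-1)p$ points $\{x^{(m)}_{i,q}\}$, $i=1,\dots,p$, $q=1,\dots,m-1$, where $x^{(m)}_{i,q}$ is determined by $$k\bigl(x^{(m)}_{i,q}\bigr)=\frac{i-1}{p}+\frac{q}{mp}.$$
   Context: Let $p\ge 1$ and let $\{a_n\}_{n\ge1}$, $\{b_n\}_{n\ge1}$ be real sequences with $a_n>0$, $a_{n+p}=a_n$, $b_{n+p}=b_n$. The orthonormal polynomials $p_n$ are defined by $p_{-1}\equiv0$, $p_0\equiv1$, $xp_n(x)=a_{n+1}p_{n+1}(x)+b_{n+1}p_n(x)+a_np_{n-1}(x)$ for $n\ge0$ (with $a_0:=a_p$); $P_n$ is the monic multiple of $p_n$ (same zeros). Let $A_k(z)=\frac1{a_{k+1}}\begin{pmatrix} z-b_{k+1}&-a_k\\ a_{k+1}&0\end{pmatrix}$, $T_n(z)=A_{n-1}(z)\cdots A_0(z)$, and $\Delta(z)=\mathrm{Tr}(T_p(z))$. The polynomial $\Delta$ has degree $p$, and $\{z\in\mathbb C:\Delta(z)\in(-2,2)\}$ is a union of $p$ disjoint open real intervals $(\alpha_j,\beta_j)$, with $\alpha_1<\beta_1\le\alpha_2<\beta_2\le\cdots\le\alpha_p<\beta_p$. The bands are the intervals $[\alpha_j,\beta_j]$, $j=1,\dots,p$, and the $j$-th gap ($1\le j\le p-1$) is $(\beta_j,\alpha_{j+1})$;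 it is closed if $\beta_j=\alpha_{j+1}$. The Dirichlet data points are the real $x$ for which $\binom10$ is an eigenvector of $T_p(x)$, i.e. the $(2,1)$ entry of $T_p(x)$ vanishes. There are exactly $p-1$ of them, $x_1,\dots,x_{p-1}$, with $\beta_j\le x_j\le\alpha_{j+1}$ (closed gaps included). $dk$ is the (probability) logarithmic-potential-theoretic equilibrium measure of $B=\bigcup_{j=1}^p[\alpha_j,\beta_j]$, and $k(x)=\int_{\alpha_1}^x dk$; one has $k(\beta_j)=k(\alpha_{j+1})=j/p$. *)

(* Defs.v *)
From mathcomp Require Import all_boot all_order all_algebra complex.
From mathcomp Require Import all_classical all_reals all_analysis.

Set Implicit Arguments.
Unset Strict Implicit.
Unset Printing Implicit Defensive.

Import Order.TTheory GRing.Theory Num.Theory.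
Import numFieldNormedType.Exports.

Local Open Scope classical_set_scope.
Local Open Scope ring_scope.
Local Open Scope complex_scope.

Section PeriodicJacobi.
Context {R : realType}.
Implicit Types (p n k : nat) (a b alpha beta x : nat -> R).

(* The coefficients are indexed from 1; the value [a 0] is the convention
   a_0 := a_p, and [b 0] is never used. *)
Definition periodic_jacobi p a b : Prop :=
  [/\ forall n, (1 <= n)%N -> 0 < a n,
      forall n, (1 <= n)%N -> a (n + p)%N = a n,
      forall n, (1 <= n)%N -> b (n + p)%N = b n
    & a 0%N = a p].

(* x p_n = a_{n+1} p_{n+1} + b_{n+1} p_n + a_n p_{n-1}, solved for p_{n+1};
   the inner match is p_{n-1}, with p_{-1} = 0. *)
Fixpoint orthonormal_poly a b n : {poly R} :=
  if n is n1.+1 then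
    (a n1.+1)^-1 *:
      (('X - (b n1.+1)%:P) * orthonormal_poly a b n1
       - a n1 *: (if n1 is n2.+1 then orthonormal_poly a b n2 else 0))
  else 1.

Definition monic_orthogonal_poly a b n : {poly R} :=
  (lead_coef (orthonormal_poly a b n))^-1 *: orthonormal_poly a b n.

(* Matrices over {poly R}: the indeterminate 'X stands for the spectral
   parameter z. *)
Definition one_step_matrix a b k : 'M[{poly R}]_2 :=
  ((a k.+1)^-1)%:P *:
  \matrix_(i < 2, j < 2)
    (nth [::] [:: [:: 'X - (b k.+1)%:P; - (a k)%:P];
                  [:: (a k.+1)%:P;      0          ]] i)`_j.

Fixpoint transfer_matrix a b n : 'M[{poly R}]_2 :=
  if n is n1.+1 then one_step_matrix a b n1 *m transfer_matrix a b n1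
  else 1%:M.

Definition discriminant p a b : {poly R} := \tr (transfer_matrix a b p).

(* The endpoints are indexed by 1, ..., p; other values are irrelevant. *)
Definition band_edges p a b alpha beta : Prop :=
  [/\ forall j, (1 <= j <= p)%N -> alpha j < beta j,
      forall j, (1 <= j < p)%N -> beta j <= alpha j.+1
    & forall z : R[i],
        (exists2 c : R, -2 < c < 2 &
           (map_poly (real_complex R) (discriminant p a b)).[z] = c%:C)
        <->
        (exists2 j, (1 <= j <= p)%N &
           exists2 t : R, alpha j < t < beta j & z = t%:C)].

Definition bands p alpha beta : set R :=
  \bigcup_(j in [set j | (1 <= j <= p)%N]) `[alpha j, beta j]%classic.

Definition is_dirichlet_point p a b (t : R) : Prop :=
  let e1 : 'cV[R]_2 := delta_mx 0 0 in
  exists lambda : R,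
    map_mx (horner_eval t) (transfer_matrix a b p) *m e1 = lambda *: e1.

(* [x] is indexed by 1, ..., p - 1; other values are irrelevant. *)
Definition dirichlet_data p a b alpha beta x : Prop :=
  (forall t, is_dirichlet_point p a b t <->
     exists2 j, (1 <= j <= p.-1)%N & t = x j) /\
  (forall j, (1 <= j <= p.-1)%N -> beta j <= x j <= alpha j.+1).

(* The kernel is log |s - t|^-1; [lne] is used because it is -oo at 0, so that
   the kernel is +oo on the diagonal, whereas [ln 0 = 0]. *)
Definition log_energy (mu : probability (measurableTypeR R) R) : \bar R :=
  (\int[mu]_s \int[mu]_t - lne (`|s - t|%R)%:E)%E.

Definition is_equilibrium_measure (B : set R)
    (mu : probability (measurableTypeR R) R) : Prop :=
  mu B = 1%E /\
  forall nu : probability (measurableTypeR R) R,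
    nu B = 1%E -> (log_energy mu <= log_energy nu)%E.

Definition integrated_from (mu : probability (measurableTypeR R) R)
    (alpha1 x : R) : R := fine (mu `[alpha1, x]%classic).

End PeriodicJacobi.

(* Main.v *)
From HB Require Import structures.
Require Import Defs.
From mathcomp Require Import all_boot all_order all_algebra complex.
From mathcomp Require Import all_classical all_reals all_analysis.
From mathcomp Require Import measurable_realfun ring lra zify.

Import Order.TTheory GRing.Theory Num.Theory.
Import numFieldNormedType.Exports.

Local Open Scope classical_set_scope.
Local Open Scope ring_scope.
Local Open Scope complex_scope.

(** Everything is governed by the discriminant D, which maps each band bijectively
    onto [-2, 2].

    Zeros. The first column of the transfer matrix over n steps is (p_n, p_{n-1}).
    Over one period the transfer matrix T has trace D and, as a_0 = a_p,
    determinant 1, so the Cayley-Hamilton identity expresses T^m through the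
    Chebyshev polynomials of the second kind. The lower left entry gives
      p_{mp-1} = U_m(D) p_{p-1},   U_m(2 cos u) = sin(m u) / sin u
    (orthonormal_poly_factor). The zeros of p_{p-1} are the p - 1 Dirichlet points,
    which are distinct because a band separates two consecutive ones. Those of
    U_m(D) are the solutions of D = 2 cos(pi q/m) with 0 < q < m.

    Bands. For c in (-2, 2) the polynomial D - c has only real roots, hence it
    satisfies the Laguerre inequality f'^2 - f f'' > 0 where it does not vanish. At
    a critical point of D in an open band this would force D'' to have both signs
    (deriv_band_neq0). So D is strictly monotone on each band and runs between -2
    and 2, and each value in (-2, 2) is taken exactly once in every band.

    Equilibrium measure. Let mu0 give mass 1/p to each band, distributed there so
    that D follows the arcsine law, the law of 2 cos(pi s) for s uniform on [0, 1].
    Since D(x) - v is, up to a constant factor, the product over the bands of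
    x - t_i(v), where t_i(v) is the preimage of v in the i-th band, the potential of
    mu0 at x is an affine function of the potential of the arcsine law at D(x); the
    latter is constant on [-2, 2] (arcsine_potential), so the former is constant on
    the bands (band_potential). It follows that the energy of dk - mu0 is
    I(dk) - I(mu0), which is nonpositive when dk is a minimizer.

    On the other hand, after rescaling the bands into [-2, 2], the expansion
      - log |2 cos u - 2 cos v| = sum over n >= 1 of (2/n) cos(n u) cos(n v)
    shows that the energy of a signed measure of mass 0 is a positive combination of
    squares of its Chebyshev moments. Therefore all moments of dk and mu0 agree
    (energy_separates), and so do the measures (moment_distribution_eq). The series
    does not converge uniformly; it is damped by a factor r^n and the resulting
    kernel is shifted by ln r, which makes it increase to the logarithmic kernel as
    r increases to 1. Monotone convergence then controls all energies.

    Consequently k(t) = (i - 1 + G)/p for t in the i-th band, where G increases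
    from 0 to 1 along the band and D(t) = 2 cos(pi G) or - 2 cos(pi G) according
    to whether D decreases or increases (equilibrium_cdf). The level
    (i - 1)/p + q/(mp) corresponds to G = q/m, that is, to D = 2 cos(pi q/m) or
    2 cos(pi (m - q)/m). *)

(** * Logarithmic series of the Poisson denominator *)

Section LogSeries.
Context {R : realType}.
Implicit Types (r u : R) (n N : nat).

(** The squared modulus of 1 - r exp(i u). *)
Definition poisson_den r u : R := 1 - 2 * r * cos u + r ^+ 2.

Lemma poisson_den_ge r u : 0 <= r -> (1 - r) ^+ 2 <= poisson_den r u.
Proof.
move=> r0; rewrite /poisson_den; have := cos_le1 u => c1.
have : r * cos u <= r by rewrite ler_piMr.
by lra.
Qed.

Lemma poisson_den_gt0 r u : 0 <= r < 1 -> 0 < poisson_den r u.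
Proof.
move=> /andP[r0 r1]; apply: lt_le_trans (poisson_den_ge _ u r0).
by rewrite exprn_gt0// subr_gt0.
Qed.

(** The partial sums of Re (- log (1 - r exp(i u))). *)
Definition log_series r u N : R :=
  \sum_(1 <= n < N.+1) r ^+ n * cos (n%:R * u) / n%:R.

Lemma cos_recr n u :
  cos (n.+2%:R * u) = 2 * cos u * cos (n.+1%:R * u) - cos (n%:R * u).
Proof.
have -> : n.+2%:R * u = n.+1%:R * u + u by rewrite -[n.+2]addn1 natrD; ring.
have -> : n%:R * u = n.+1%:R * u - u by rewrite -[n.+1]addn1 natrD; ring.
rewrite cosD cosB; ring.
Qed.

(** The geometric sum of r^n cos((n+1) u) telescopes once multiplied by the
    squared modulus of 1 - r exp(i u), because of the three-term recurrence of
    the cosines. *)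
Lemma poisson_sum r u N :
  poisson_den r u * \sum_(0 <= n < N) r ^+ n * cos (n.+1%:R * u) =
  cos u - r - r ^+ N * (cos (N.+1%:R * u) - r * cos (N%:R * u)).
Proof.
elim: N => [|N IH].
  by rewrite big_geq// mulr0 expr0 !mul1r mul0r cos0; ring.
rewrite big_nat_recr//= mulrDr IH /poisson_den cos_recr !exprS; ring.
Qed.

Lemma is_derive_log_series r u N :
  is_derive r (1 : R) (fun s => log_series s u N)
    (\sum_(0 <= n < N) r ^+ n * cos (n.+1%:R * u)).
Proof.
elim: N => [|N IH].
  rewrite big_geq//.
  rewrite (_ : (fun s => _) = cst 0); last first.
    by apply/funext => s; rewrite /log_series big_geq.
  exact: is_derive_cst.
rewrite (_ : (fun s => _) = (fun s => log_series s u N) +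
   ((cos (N.+1%:R * u) / N.+1%:R) \*: (id ^+ N.+1))); last first.
  apply/funext => s; rewrite /log_series big_nat_recr//= /GRing.add/= /GRing.scale/=.
  congr (_ + _); rewrite fctE; ring.
apply: is_derive_eq.
rewrite big_nat_recr//=; congr (_ + _).
rewrite /GRing.scale/= /id; field.
by rewrite nat1r pnatr_eq0.
Qed.

Lemma is_derive_log_poisson r u : 0 <= r < 1 ->
  is_derive r (1 : R) (fun s => - (ln (poisson_den s u) / 2))
    ((cos u - r) / poisson_den r u).
Proof.
move=> r01; have q0 := poisson_den_gt0 _ u r01.
have dq : is_derive r (1 : R) (fun s => poisson_den s u) (- 2 * cos u + 2 * r).
  rewrite (_ : (fun s => _) =
     cst 1 - ((2 * cos u) \*: id) + (id ^+ 2)); last first.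
    by apply/funext => s; rewrite /poisson_den !fctE/= /GRing.scale/=; ring.
  apply: (@is_derive_eq _ _ _ _ _ _ _ _ (is_deriveD (is_deriveB
    (is_derive_cst _ _ _) (is_deriveZ _ (is_derive_id _ _)))
    (is_deriveX _ (is_derive_id _ _)))).
  by rewrite /GRing.scale/= /id; ring.
have dl := is_derive1_ln q0.
rewrite (_ : (fun s => _) = (- 2^-1) \*: (@ln R \o (fun s => poisson_den s u))); last first.
  by apply/funext => s /=; rewrite /GRing.scale/=; ring.
apply: is_derive_eq; rewrite /GRing.scale/=.
field; exact: lt0r_neq0.
Qed.

(** Both sides vanish at r = 0 and their r-derivatives differ by the remainder
    of a geometric series, so the mean value theorem bounds the difference. The
    bound does not depend on u, which is what allows integration of the series
    term by term. *)
Lemma log_series_error r u N : 0 <= r < 1 ->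
  `|- (ln (poisson_den r u) / 2) - log_series r u N| <= 2 * r ^+ N / (1 - r) ^+ 2.
Proof.
move=> /andP[r0 r1].
pose f (s : R) := - (ln (poisson_den s u) / 2) - log_series s u N.
pose df s := (s ^+ N * (cos (N.+1%:R * u) - s * cos (N%:R * u))) / poisson_den s u.
have dfP (s : R) : 0 <= s < 1 -> is_derive s (1 : R) f (df s).
  move=> s01; have q0 := poisson_den_gt0 _ u s01.
  have d1 := is_derive_log_poisson _ u s01.
  have d2 := is_derive_log_series s u N.
  apply: (is_derive_eq (is_deriveB d1 d2)).
  rewrite /df; apply: (mulfI (lt0r_neq0 q0)).
  rewrite mulrBr poisson_sum.
  field; exact: lt0r_neq0.
have f0 : f 0 = 0.
  rewrite /f /poisson_den mulr0 mul0r subr0 expr0n/= addr0 ln1 mul0r oppr0 add0r.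
  rewrite /log_series big_nat big1 ?oppr0// => n /andP[n1 _].
  by rewrite expr0n -leqn0 leqNgt n1/= !mul0r.
have [s] : exists2 c, c \in `[0, r] & f r - f 0 = df c * (r - 0).
  apply: MVT_segment => //.
    move=> s; rewrite in_itv/= => /andP[s0 sr]; apply: dfP.
    by rewrite ltW//= (lt_trans sr).
  apply: derivable_within_continuous => s; rewrite in_itv/= => /andP[s0 sr].
  by have [] := dfP s; rewrite ?s0 ?(le_lt_trans sr).
rewrite in_itv/= f0 !subr0 => /andP[s0 sr]; rewrite -/(f r) => ->.
have s1 := le_lt_trans sr r1.
have q0 : 0 < poisson_den s u by rewrite poisson_den_gt0// s0.
have q1 : (1 - r) ^+ 2 <= poisson_den s u.
  apply: le_trans (poisson_den_ge _ u s0).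
  rewrite lerXn2r ?nnegrE ?subr_ge0 ?(ltW s1) ?(ltW r1)//.
  by rewrite lerD2l lerN2.
rewrite /df !normrM normfV (ger0_norm (ltW q0)) (ger0_norm r0) normrX (ger0_norm s0).
apply: (@le_trans _ _ (s ^+ N * 2 / poisson_den s u)); last first.
  rewrite [2 * _]mulrC ler_pM ?invr_ge0 ?mulr_ge0 ?exprn_ge0 ?(ltW q0)//.
    by rewrite ler_pM2r// lerXn2r.
  by rewrite lef_pV2// posrE exprn_gt0// subr_gt0.
apply: (@le_trans _ _ (s ^+ N * `|cos (N.+1%:R * u) - s * cos (N%:R * u)| / poisson_den s u)).
  by rewrite ler_piMr ?mulr_ge0 ?exprn_ge0 ?invr_ge0 ?(ltW q0) ?(ltW r1).
rewrite ler_pM2r ?invr_gt0// ler_wpM2l ?exprn_ge0//.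
apply: le_trans (ler_normB _ _) _.
rewrite normrM (ger0_norm s0).
have c1 n : `|cos (n%:R * u)| <= 1 by rewrite ler_norml cos_geN1 cos_le1.
have : s * `|cos (N%:R * u)| <= 1 by rewrite mulr_ile1 ?(ltW s1).
by have := c1 N.+1; lra.
Qed.

End LogSeries.

(** * The logarithmic kernel and its regularization *)

Section Kernel.
Context {R : realType}.
Implicit Types (X Y a : R) (n N j : nat).

(** The Chebyshev polynomials normalized so that cheb n (2 cos u) = 2 cos(n u),
    which suits the interval [-2, 2]. *)
Fixpoint cheb n X : R :=
  match n with
  | 0 => 2
  | 1 => X
  | n1.+1 => if n1 is n2.+1 then X * cheb n1 X - cheb n2 X else X
  end.

Lemma chebSS n X : cheb n.+2 X = X * cheb n.+1 X - cheb n X.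
Proof. by []. Qed.

Lemma cheb_cos n u : cheb n (2 * cos u) = 2 * cos (n%:R * u).
Proof.
suff [] : cheb n (2 * cos u) = 2 * cos (n%:R * u) /\
   cheb n.+1 (2 * cos u) = 2 * cos (n.+1%:R * u) by [].
elim: n => [|n [IH1 IH2]].
  by rewrite mul0r cos0 mul1r /= mulr1.
split=> //; rewrite chebSS IH1 IH2 cos_recr; ring.
Qed.

Lemma cos_param X : -2 <= X <= 2 -> exists u, X = 2 * cos u.
Proof.
move=> X2; exists (acos (X / 2)); rewrite acosK ?in_itv/=; last by lra.
by field.
Qed.

Lemma cheb_bound n X : -2 <= X <= 2 -> `|cheb n X| <= 2.
Proof.
move=> /cos_param[u ->]; rewrite cheb_cos.
by rewrite ler_norml; have := cos_le1 (n%:R * u); have := cos_geN1 (n%:R * u); lra.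
Qed.

Definition reg_radius j : R := j.+1%:R / j.+2%:R.
(** With r the radius, this is r + 1/r; it decreases to 2 as r increases to 1. *)
Definition reg_shift j : R := reg_radius j + (reg_radius j)^-1.
(** A deformation of (X - Y)^2, recovered for a = 2. For X = 2 cos u,
    Y = 2 cos v and a = r + 1/r it is the product of the squared moduli of
    1 - r exp(i(u-v)) and 1 - r exp(i(u+v)), divided by r^2; dividing by r^2 is
    what makes it monotone in r. *)
Definition reg_sqdist a X Y : R := a ^+ 2 - a * X * Y + X ^+ 2 + Y ^+ 2 - 4.

Lemma reg_radius_itv j : 2^-1 <= reg_radius j < 1.
Proof.
rewrite /reg_radius ltr_pdivrMr ?ltr0n// mul1r ltr_nat ltnSn andbT.
by rewrite ler_pdivlMr ?ltr0n// mulrC ler_pdivrMr ?ltr0n// -natrM ler_nat; lia.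
Qed.

Lemma reg_shiftE j : reg_shift j = 2 + j.+1%:R^-1 * j.+2%:R^-1.
Proof.
rewrite /reg_shift /reg_radius invf_div.
have : (j.+2%:R : R) = j.+1%:R + 1 by rewrite -natr1.
have : (0 : R) < j.+1%:R by rewrite ltr0n.
move: (j.+1%:R) => x x0 ->; field.
by rewrite !lt0r_neq0//; lra.
Qed.

Lemma reg_shift_gt2 j : 2 < reg_shift j.
Proof. by rewrite reg_shiftE ltrDl mulr_gt0 ?invr_gt0 ?ltr0n. Qed.

Lemma reg_shift_noninc i j : (i <= j)%N -> reg_shift j <= reg_shift i.
Proof.
move=> ij; rewrite !reg_shiftE lerD2l ler_pM ?invr_ge0 ?ler0n//.
  by rewrite lef_pV2 ?posrE ?ltr0n// ler_nat ltnS.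
by rewrite lef_pV2 ?posrE ?ltr0n// ler_nat !ltnS.
Qed.

Lemma reg_shift_le j : reg_shift j <= 5 / 2.
Proof.
apply: le_trans (reg_shift_noninc 0 j (leq0n _)) _.
by rewrite reg_shiftE invr1; lra.
Qed.

Lemma cvg_reg_shift : reg_shift j @[j --> \oo] --> (2 : R).
Proof.
rewrite (_ : (fun j => _) = (fun j => 2 + j.+1%:R^-1 * j.+2%:R^-1)); last first.
  by apply/funext => j; rewrite reg_shiftE.
rewrite -[X in _ --> X](_ : 2 + 0 * 0 = 2 :> R); last by ring.
apply: cvgD; first exact: cvg_cst.
apply: cvgM; first exact: cvg_harmonic.
have := @cvg_harmonic R.
by rewrite -cvg_shiftS.
Qed.

Lemma mul_itv2 X Y : -2 <= X <= 2 -> -2 <= Y <= 2 -> -4 <= X * Y <= 4.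
Proof. by move=> X2 Y2; nra. Qed.

Lemma reg_sqdist2 X Y : reg_sqdist 2 X Y = (X - Y) ^+ 2.
Proof. rewrite /reg_sqdist; ring. Qed.

Lemma reg_sqdist_mono a1 a2 X Y : -2 <= X <= 2 -> -2 <= Y <= 2 ->
  2 <= a1 <= a2 -> reg_sqdist a1 X Y <= reg_sqdist a2 X Y.
Proof.
move=> X2 Y2 a12; have := mul_itv2 _ _ X2 Y2 => XY.
rewrite -subr_ge0 (_ : _ - _ = (a2 - a1) * (a1 + a2 - X * Y)); last first.
  by rewrite /reg_sqdist; ring.
by apply: mulr_ge0; lra.
Qed.

Lemma reg_sqdist_gt0 a X Y : -2 <= X <= 2 -> -2 <= Y <= 2 ->
  2 < a -> 0 < reg_sqdist a X Y.
Proof.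
move=> X2 Y2 a2; have := mul_itv2 _ _ X2 Y2 => XY.
have -> : reg_sqdist a X Y = (X - Y) ^+ 2 + (a - 2) * (a + 2 - X * Y).
  by rewrite /reg_sqdist; ring.
have := sqr_ge0 (X - Y).
have : 0 < (a - 2) * (a + 2 - X * Y) by apply: mulr_gt0; lra.
by lra.
Qed.

(** The term ln 8 makes the kernel nonnegative on [-2, 2], so that monotone
    convergence and Tonelli's theorem apply without integrability conditions. *)
Definition log_kernel_reg j X Y : R :=
  ln 8 - ln (reg_sqdist (reg_shift j) X Y) / 2.

Definition log_kernel X Y : \bar R := ((ln 8)%:E - lne `|X - Y|%:E)%E.

Lemma reg_sqdist_poisson j u v :
  reg_sqdist (reg_shift j) (2 * cos u) (2 * cos v) =
  poisson_den (reg_radius j) (u - v) * poisson_den (reg_radius j) (u + v) /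
    reg_radius j ^+ 2.
Proof.
have r0 : reg_radius j != 0.
  by apply: lt0r_neq0; have := reg_radius_itv j; lra.
rewrite /reg_sqdist /reg_shift /poisson_den cosB cosD.
move: (reg_radius j) r0 => r r0.
have := cos2Dsin2 u; have := cos2Dsin2 v.
move: (cos u) (cos v) (sin u) (sin v) => c d s t e1 e2.
have st : (s * t) ^+ 2 = (1 - c ^+ 2) * (1 - d ^+ 2).
  by rewrite exprMn; congr (_ * _); lra.
apply: (mulIf (expf_neq0 2 r0)); rewrite divfK ?expf_neq0//.
rewrite [LHS](_ : _ = (1 + r ^+ 2) ^+ 2 - 2 * r * (1 + r ^+ 2) * 2 * c * d
   + 4 * r ^+ 2 * (c ^+ 2 * d ^+ 2 - (1 - c ^+ 2) * (1 - d ^+ 2))); last by field.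
rewrite -st; ring.
Qed.

(** The expansion that diagonalizes the kernel: the product formula for the
    deformed distance splits its logarithm into two logarithmic series, at u - v
    and u + v, and cos(n(u-v)) + cos(n(u+v)) = 2 cos(n u) cos(n v). All
    coefficients are positive, whence the positivity of the energy. *)
Lemma log_kernel_reg_series j X Y N : -2 <= X <= 2 -> -2 <= Y <= 2 ->
  `|log_kernel_reg j X Y - (ln 8 + ln (reg_radius j) +
     \sum_(1 <= n < N.+1) reg_radius j ^+ n / (2 * n%:R) * cheb n X * cheb n Y)|
  <= 4 * reg_radius j ^+ N / (1 - reg_radius j) ^+ 2.
Proof.
move=> /cos_param[u ->] /cos_param[v ->].
have := reg_radius_itv j => r01.
have r01' : 0 <= reg_radius j < 1 by lra.
have E1 := log_series_error _ (u - v) N r01'.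
have E2 := log_series_error _ (u + v) N r01'.
rewrite /log_kernel_reg reg_sqdist_poisson.
have q1 := poisson_den_gt0 _ (u - v) r01'.
have q2 := poisson_den_gt0 _ (u + v) r01'.
have r0 : 0 < reg_radius j by lra.
rewrite ln_div ?posrE ?mulr_gt0 ?exprn_gt0// lnM ?posrE// lnXn//.
have -> : \sum_(1 <= n < N.+1) reg_radius j ^+ n / (2 * n%:R) *
     cheb n (2 * cos u) * cheb n (2 * cos v) =
  log_series (reg_radius j) (u - v) N + log_series (reg_radius j) (u + v) N.
  rewrite /log_series -big_split/= !big_nat; apply: eq_bigr => n /andP[n1 _].
  rewrite !cheb_cos mulrBr mulrDr cosB cosD.
  field; by rewrite pnatr_eq0 -lt0n.
rewrite mulr2n.
apply: le_trans (_ : _ <= 2 * reg_radius j ^+ N / (1 - reg_radius j) ^+ 2 +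
   2 * reg_radius j ^+ N / (1 - reg_radius j) ^+ 2) _; last by lra.
apply: le_trans (lerD E1 E2).
apply: le_trans (ler_normD _ _).
by rewrite le_eqVlt; apply/orP; left; apply/eqP; congr `| _ |; lra.
Qed.

Lemma log_kernel_reg_ge0 j X Y : -2 <= X <= 2 -> -2 <= Y <= 2 ->
  0 <= log_kernel_reg j X Y.
Proof.
move=> X2 Y2; rewrite /log_kernel_reg subr_ge0.
have D0 := reg_sqdist_gt0 _ _ _ X2 Y2 (reg_shift_gt2 j).
have XY := mul_itv2 _ _ X2 Y2.
have D64 : reg_sqdist (reg_shift j) X Y <= 8 ^+ 2.
  have a2 := reg_shift_gt2 j; have a52 := reg_shift_le j.
  apply: (@le_trans _ _ (reg_sqdist (5 / 2) X Y)).
    by apply: reg_sqdist_mono => //; lra.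
  by rewrite /reg_sqdist; nra.
have : ln (reg_sqdist (reg_shift j) X Y) <= ln (8 ^+ 2).
  by rewrite ler_ln ?posrE.
by rewrite lnXn// mulr2n; lra.
Qed.

Lemma log_kernel_reg_nondec i j X Y : -2 <= X <= 2 -> -2 <= Y <= 2 ->
  (i <= j)%N -> log_kernel_reg i X Y <= log_kernel_reg j X Y.
Proof.
move=> X2 Y2 ij; rewrite /log_kernel_reg lerD2l lerN2 ler_pM2r ?invr_gt0//.
rewrite ler_ln ?posrE ?reg_sqdist_gt0 ?reg_shift_gt2//.
by apply: reg_sqdist_mono => //; rewrite reg_shift_noninc// ltW ?reg_shift_gt2.
Qed.

(** This includes the diagonal, where both the kernel and the limit are
    infinite. *)
Lemma cvg_log_kernel_reg X Y : -2 <= X <= 2 -> -2 <= Y <= 2 ->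
  (log_kernel_reg j X Y)%:E @[j --> \oo] --> log_kernel X Y.
Proof.
move=> X2 Y2.
have cD : reg_sqdist (reg_shift j) X Y @[j --> \oo] --> (X - Y) ^+ 2.
  rewrite -reg_sqdist2 /reg_sqdist.
  have ca := cvg_reg_shift.
  apply: cvgB; last exact: cvg_cst.
  apply: cvgD; last exact: cvg_cst.
  apply: cvgD; last exact: cvg_cst.
  apply: cvgB.
    by under eq_fun do rewrite expr2; rewrite expr2; exact: cvgM.
  apply: cvgM; last exact: cvg_cst.
  by apply: cvgM; last exact: cvg_cst.
have [XY|XY] := eqVneq X Y.
  rewrite /log_kernel XY subrr normr0 le0_lneNy//=.
  rewrite XY subrr expr0n/= in cD.
  apply/cvgeryP/cvgryPge => M.
  have e0 : 0 < expR (2 * (ln 8 - M)) by exact: expR_gt0.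
  have /cvgr_lt/(_ _ e0) := cD; apply: filterS => j Dj.
  rewrite /log_kernel_reg.
  have D0 := reg_sqdist_gt0 _ _ _ X2 Y2 (reg_shift_gt2 j).
  rewrite XY in D0.
  move: Dj; rewrite -ltr_ln ?posrE// expRK; lra.
rewrite /log_kernel lne_EFin ?normr_gt0 ?subr_eq0//.
rewrite -EFinB; apply: cvg_EFin; first exact: nearW.
have -> : ln `|X - Y| = ln ((X - Y) ^+ 2) / 2.
  rewrite -real_normK ?num_real// lnXn ?normr_gt0 ?subr_eq0// mulr2n; lra.
apply: cvgB; first exact: cvg_cst.
apply: cvgM; last exact: cvg_cst.
apply: continuous_cvg => //.
apply: continuous_ln.
by rewrite exprn_even_gt0//= subr_eq0.
Qed.

End Kernel.

(** * Integrals against a probability measure *)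

Section ProbabilityIntegrals.
Context {R : realType} {d} {T : measurableType d} (mu : probability T R).

Lemma measure_setT : (mu : {measure set T -> \bar R}) setT = 1%E.
Proof. exact: probability_setT. Qed.

Lemma bounded_integrable (f : T -> R) (M : R) :
  measurable_fun setT f -> (forall x, `|f x| <= M) ->
  mu.-integrable setT (EFin \o f).
Proof.
move=> mf fM; apply: measurable_bounded_integrable => //.
  by rewrite -ge0_fin_numE// fin_num_measure.
exists M; split; first exact: num_real.
by move=> N MN x _ /=; apply: le_trans (fM x) (ltW MN).
Qed.

Lemma Rintegral_prob_cst (c : R) : \int[mu]_x c = c.
Proof. by rewrite Rintegral_cst// measure_setT mulr1. Qed.

Lemma integrable_cst_prob (c : R) : mu.-integrable setT (EFin \o (fun=> c)).
Proof. exact: (@bounded_integrable _ `|c|). Qed.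

Lemma EFin_Rintegral (f : T -> R) : mu.-integrable setT (EFin \o f) ->
  (\int[mu]_x f x)%:E = (\int[mu]_x (f x)%:E)%E.
Proof. by move=> fi; rewrite fineK//; exact: integrable_fin_num. Qed.

Lemma integrable_lincomb (A : R) (a : nat -> R) (w : nat -> T -> R) (N : nat) :
  (forall n, mu.-integrable setT (EFin \o w n)) ->
  mu.-integrable setT
    (EFin \o (fun t => A + \sum_(1 <= n < N.+1) a n * w n t)) /\
  \int[mu]_t (A + \sum_(1 <= n < N.+1) a n * w n t) =
    A + \sum_(1 <= n < N.+1) a n * \int[mu]_t w n t.
Proof.
move=> wi; elim: N => [|N [IH1 IH2]].
  rewrite (_ : (fun t => _) = (fun=> A)); last first.
    by apply/funext => t; rewrite big_geq ?addr0.
  by split; [exact: integrable_cst_prob|rewrite Rintegral_prob_cst big_geq ?addr0].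
have E t : A + \sum_(1 <= n < N.+2) a n * w n t =
    (A + \sum_(1 <= n < N.+1) a n * w n t) + a N.+1 * w N.+1 t.
  by rewrite (big_nat_recr N.+1)//= addrA.
have wi' : mu.-integrable setT (EFin \o (fun t => a N.+1 * w N.+1 t)).
  have := integrableZl measurableT (a N.+1) (wi N.+1).
  by apply: eq_integrable => //= t _; rewrite EFinM.
split.
  have := integrableD measurableT IH1 wi'.
  by apply: eq_integrable => //= t _; rewrite E EFinD.
under eq_Rintegral do rewrite E.
rewrite RintegralD// IH2 RintegralZl//.
by rewrite [in RHS](big_nat_recr N.+1)//= addrA.
Qed.

(** Integration of an expansion with a uniform error. It is applied once in each
    variable of the kernel. *)
Lemma Rintegral_approx (G : T -> R) (A eps : R) (a : nat -> R)
    (w : nat -> T -> R) (N : nat) :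
  mu.-integrable setT (EFin \o G) ->
  (forall n, mu.-integrable setT (EFin \o w n)) ->
  (forall t, `|G t - (A + \sum_(1 <= n < N.+1) a n * w n t)| <= eps) ->
  `|\int[mu]_t G t - (A + \sum_(1 <= n < N.+1) a n * \int[mu]_t w n t)| <= eps.
Proof.
move=> Gi wi Gw.
have [Li <-] := integrable_lincomb A a w N wi.
rewrite -RintegralB//.
have Di : mu.-integrable setT
    (EFin \o (fun t => G t - (A + \sum_(1 <= n < N.+1) a n * w n t))).
  have := integrableB measurableT Gi Li.
  by apply: eq_integrable => //= t _; rewrite EFinB.
apply: le_trans (le_normr_Rintegral _ _ ) _ => //.
rewrite -[leRHS]Rintegral_prob_cst; apply: le_Rintegral => //.
  have := integrable_norm Di.
  by apply: eq_integrable.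
exact: integrable_cst_prob.
Qed.

End ProbabilityIntegrals.

(** * Positivity of the logarithmic energy *)

Section Energy.
Context {R : realType}.
Local Open Scope ereal_scope.

Lemma log_kernel_ge0 (X Y : R) : (-2 <= X <= 2)%R -> (-2 <= Y <= 2)%R ->
  0 <= log_kernel X Y.
Proof.
move=> X2 Y2; have /cvg_lim <- // := cvg_log_kernel_reg X Y X2 Y2.
apply: lime_ge.
  by apply/cvg_ex; eexists; exact: cvg_log_kernel_reg.
by apply: nearW => j; rewrite lee_fin log_kernel_reg_ge0.
Qed.

Lemma log_kernel_reg_le j (X Y : R) : (-2 <= X <= 2)%R -> (-2 <= Y <= 2)%R ->
  (log_kernel_reg j X Y)%:E <= log_kernel X Y.
Proof.
move=> X2 Y2; have /cvg_lim <- // := cvg_log_kernel_reg X Y X2 Y2.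
apply: lime_ge.
  by apply/cvg_ex; eexists; exact: cvg_log_kernel_reg.
by exists j => // i /= ji; rewrite lee_fin log_kernel_reg_nondec.
Qed.

Section TwoSpaces.
Context {d1} {T1 : measurableType d1} {d2} {T2 : measurableType d2}.
Variables (mu : probability T1 R) (nu : probability T2 R).
Variables (X : T1 -> R) (Y : T2 -> R).
Hypotheses (mX : measurable_fun setT X) (mY : measurable_fun setT Y).
Hypotheses (X2 : forall s, (-2 <= X s <= 2)%R) (Y2 : forall t, (-2 <= Y t <= 2)%R).

Lemma measurable_log_kernel_reg j :
  measurable_fun setT (fun z : T1 * T2 => log_kernel_reg j (X z.1) (Y z.2)).
Proof.
have mX1 : measurable_fun setT (fun z : T1 * T2 => X z.1).
  exact: measurableT_comp.
have mY1 : measurable_fun setT (fun z : T1 * T2 => Y z.2).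
  exact: measurableT_comp.
rewrite /log_kernel_reg; apply: measurable_funB => //.
apply: measurable_funM => //.
apply: (measurableT_comp (@measurable_ln R)).
rewrite /reg_sqdist; apply: measurable_funB => //.
apply: measurable_funD; last exact: measurable_funX.
apply: measurable_funD; last exact: measurable_funX.
apply: measurable_funB => //; apply: measurable_funM => //.
exact: measurable_funM.
Qed.

Lemma measurable_log_kernel :
  measurable_fun setT (fun z : T1 * T2 => log_kernel (X z.1) (Y z.2)).
Proof.
apply: (emeasurable_fun_cvg
  (fun j (z : T1 * T2) => (log_kernel_reg j (X z.1) (Y z.2))%:E)).
  by move=> j; apply/measurable_EFinP; exact: measurable_log_kernel_reg.
by move=> z _; exact: cvg_log_kernel_reg.
Qed.

Lemma integrable_cheb n : nu.-integrable setT (EFin \o (cheb n \o Y)).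
Proof.
apply: (@bounded_integrable _ _ _ _ _ 2) => [|t]; last exact: cheb_bound.
apply: measurableT_comp => //.
suff [] : measurable_fun setT (@cheb R n) /\ measurable_fun setT (@cheb R n.+1) by [].
elim: n => [|n [IH1 IH2]]; first by split; [exact: measurable_cst|exact: measurable_id].
split=> //; rewrite (_ : cheb n.+2 = (fun x => x * cheb n.+1 x - cheb n x)%R).
  by apply: measurable_funB => //; apply: measurable_funM => //; exact: measurable_id.
exact/funext.
Qed.

Definition cheb_moment n : R := (\int[nu]_t cheb n (Y t))%R.

(** The uniform error of the expansion of the kernel truncated at order N. *)
Definition kernel_error j N : R :=
  (4 * reg_radius j ^+ N / (1 - reg_radius j) ^+ 2)%R.

Lemma cvg_kernel_error j : kernel_error j N @[N --> \oo] --> 0%R.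
Proof.
rewrite /kernel_error -[X in _ --> X](_ : 4 * 0 / (1 - reg_radius j) ^+ 2 = 0)%R; last by ring.
apply: cvgM; last exact: cvg_cst.
apply: cvgM; first exact: cvg_cst.
apply: cvg_expr; have := @reg_radius_itv R j => r01.
by rewrite ger0_norm; lra.
Qed.

Lemma integrable_log_kernel_reg j x : (-2 <= x <= 2)%R ->
  nu.-integrable setT (EFin \o (fun t => log_kernel_reg j x (Y t))).
Proof.
move=> x2.
apply: (@bounded_integrable _ _ _ _ _
  (kernel_error j 0 + `|ln 8 + ln (reg_radius j)|)%R) => [|t].
  rewrite /log_kernel_reg; apply: measurable_funB => //.
  apply: measurable_funM => //.
  apply: (measurableT_comp (@measurable_ln R)).
  rewrite /reg_sqdist; apply: measurable_funB => //.
  apply: measurable_funD; last exact: measurable_funX.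
  apply: measurable_funD => //.
  by apply: measurable_funB => //; apply: measurable_funM.
have := log_kernel_reg_series j _ _ 0 x2 (Y2 t); rewrite big_geq// addr0.
rewrite -/(kernel_error j 0); set K := log_kernel_reg _ _ _; set L := (ln 8 + _)%R.
by move=> KL; rewrite -[X in (`|X|)%R](subrK L) (le_trans (ler_normD _ _))// lerD2r.
Qed.

Lemma reg_potential j N x : (-2 <= x <= 2)%R ->
  (`|\int[nu]_t log_kernel_reg j x (Y t) - (ln 8 + ln (reg_radius j) +
     \sum_(1 <= n < N.+1) reg_radius j ^+ n / (2 * n%:R) * cheb_moment n * cheb n x)|
  <= kernel_error j N)%R.
Proof.
move=> x2.
have := @Rintegral_approx _ _ _ nu (fun t => log_kernel_reg j x (Y t))
  (ln 8 + ln (reg_radius j)) (kernel_error j N)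
  (fun n => reg_radius j ^+ n / (2 * n%:R) * cheb n x)%R (fun n => cheb n \o Y) N.
move=> /(_ (integrable_log_kernel_reg _ _ x2) integrable_cheb) H.
have := H (fun t => log_kernel_reg_series j _ _ N x2 (Y2 t)).
congr (`|_ - (_ + _)| <= _)%R; apply: eq_bigr => n _.
by rewrite mulrAC.
Qed.

Lemma measurable_potential (k : R -> R -> \bar R) :
  measurable_fun setT (fun z : T1 * T2 => k (X z.1) (Y z.2)) ->
  (forall s t, 0 <= k (X s) (Y t)) ->
  measurable_fun setT (fun s => \int[nu]_t k (X s) (Y t)).
Proof.
move=> mk k0.
by have := @measurable_fun_fubini_tonelli_F _ _ _ _ R nu _ mk (fun z => k0 z.1 z.2).
Qed.

Lemma cvg_potential x : (-2 <= x <= 2)%R ->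
  \int[nu]_t (log_kernel_reg j x (Y t))%:E @[j --> \oo] -->
  \int[nu]_t log_kernel x (Y t).
Proof.
move=> x2.
rewrite (_ : \int[nu]_t log_kernel x (Y t) =
  \int[nu]_t limn (fun j => (log_kernel_reg j x (Y t))%:E)); last first.
  apply: eq_integral => t _; apply/esym/cvg_lim => //.
  exact: cvg_log_kernel_reg.
apply: cvg_monotone_convergence => //.
- by move=> j; have /integrableP[] := integrable_log_kernel_reg j x x2.
- by move=> j t _; rewrite lee_fin log_kernel_reg_ge0.
- by move=> t _ i j ij; rewrite lee_fin log_kernel_reg_nondec.
Qed.

End TwoSpaces.

Section OneSpace.
Context {d} {T : measurableType d} (X : T -> R).
Hypotheses (mX : measurable_fun setT X) (X2 : forall s, (-2 <= X s <= 2)%R).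
Implicit Types mu nu : probability T R.

(** Mutual energy of two distributions read in the coordinate X, with values
    in [-2, 2]. *)
Definition energy mu nu : \bar R := \int[mu]_s \int[nu]_t log_kernel (X s) (X t).

Definition reg_energy j mu nu : R :=
  (\int[mu]_s \int[nu]_t log_kernel_reg j (X s) (X t))%R.

Lemma EFin_reg_potential nu j s :
  ((\int[nu]_t log_kernel_reg j (X s) (X t))%R)%:E =
  \int[nu]_t (log_kernel_reg j (X s) (X t))%:E.
Proof. by rewrite EFin_Rintegral//; exact: integrable_log_kernel_reg. Qed.

Lemma measurable_reg_potential nu j :
  measurable_fun setT (fun s => \int[nu]_t (log_kernel_reg j (X s) (X t))%:E).
Proof.
apply: (@measurable_potential _ _ _ _ nu X X (fun x y => (log_kernel_reg j x y)%:E)).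
  by apply/measurable_EFinP; exact: measurable_log_kernel_reg.
by move=> s t; rewrite lee_fin log_kernel_reg_ge0.
Qed.

Lemma integrable_reg_potential mu nu j :
  mu.-integrable setT
    (EFin \o (fun s => (\int[nu]_t log_kernel_reg j (X s) (X t))%R)).
Proof.
apply: (@bounded_integrable _ _ _ _ _
  (kernel_error j 0 + `|ln 8 + ln (reg_radius j)|)%R) => [|s].
  apply/measurable_EFinP.
  rewrite (_ : _ \o _ = fun s => \int[nu]_t (log_kernel_reg j (X s) (X t))%:E).
    exact: measurable_reg_potential.
  by apply/funext => s /=; rewrite EFin_reg_potential.
have := reg_potential nu X mX X2 j 0 (X s) (X2 s); rewrite big_geq// addr0.
set K := (\int[nu]_t _)%R; set L := (ln 8 + _)%R.
by move=> KL; rewrite -[X in (`|X|)%R](subrK L) (le_trans (ler_normD _ _))// lerD2r.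
Qed.

Lemma reg_energy_approx mu nu j N :
  (`|reg_energy j mu nu - (ln 8 + ln (reg_radius j) +
     \sum_(1 <= n < N.+1) reg_radius j ^+ n / (2 * n%:R) *
        (cheb_moment mu X n * cheb_moment nu X n))|
  <= kernel_error j N)%R.
Proof.
have := @Rintegral_approx _ _ _ mu
  (fun s => \int[nu]_t log_kernel_reg j (X s) (X t))%R
  (ln 8 + ln (reg_radius j)) (kernel_error j N)
  (fun n => reg_radius j ^+ n / (2 * n%:R) * cheb_moment nu X n)%R
  (fun n => cheb n \o X) N.
move=> /(_ (integrable_reg_potential _ _ _) (integrable_cheb mu X mX X2)) H.
have := H (fun s => reg_potential nu X mX X2 j N (X s) (X2 s)).
congr (`|_ - (_ + _)| <= _)%R; apply: eq_bigr => n _.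
by rewrite -/(cheb_moment mu X n) -mulrA [(cheb_moment nu X n * _)%R]mulrC.
Qed.

Lemma EFin_reg_energy mu nu j : (reg_energy j mu nu)%:E =
  \int[mu]_s \int[nu]_t (log_kernel_reg j (X s) (X t))%:E.
Proof.
rewrite /reg_energy EFin_Rintegral; last exact: integrable_reg_potential.
by apply: eq_integral => s _; rewrite EFin_reg_potential.
Qed.

Lemma measurable_log_potential nu :
  measurable_fun setT (fun s => \int[nu]_t log_kernel (X s) (X t)).
Proof.
apply: measurable_potential; first exact: measurable_log_kernel.
by move=> s t; exact: log_kernel_ge0.
Qed.

(** The regularized kernels increase to the kernel, so monotone convergence
    applies to both integrals in turn. *)
Lemma cvg_energy mu nu : (reg_energy j mu nu)%:E @[j --> \oo] --> energy mu nu.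
Proof.
rewrite /energy; under eq_fun do rewrite EFin_reg_energy.
rewrite (_ : \int[mu]_s \int[nu]_t log_kernel (X s) (X t) =
  \int[mu]_s limn (fun j => \int[nu]_t (log_kernel_reg j (X s) (X t))%:E)); last first.
  apply: eq_integral => s _; apply/esym/cvg_lim => //.
  exact: cvg_potential.
apply: cvg_monotone_convergence => //.
- by move=> j; exact: measurable_reg_potential.
- by move=> j s _; apply: integral_ge0 => t _; rewrite lee_fin log_kernel_reg_ge0.
- move=> s _ i j ij; apply: ge0_le_integral => //.
  + by move=> t _; rewrite lee_fin log_kernel_reg_ge0.
  + by have /integrableP[] := integrable_log_kernel_reg nu X mX X2 i (X s) (X2 s).
  + by have /integrableP[] := integrable_log_kernel_reg nu X mX X2 j (X s) (X2 s).
  + by move=> t _; rewrite lee_fin log_kernel_reg_nondec.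
Qed.

Lemma reg_energy_le mu nu j : (reg_energy j mu nu)%:E <= energy mu nu.
Proof.
rewrite EFin_reg_energy; apply: ge0_le_integral => //.
- by move=> s _; apply: integral_ge0 => t _; rewrite lee_fin log_kernel_reg_ge0.
- exact: measurable_reg_potential.
- exact: measurable_log_potential.
- move=> s _; apply: ge0_le_integral => //.
  + by move=> t _; rewrite lee_fin log_kernel_reg_ge0.
  + by have /integrableP[] := integrable_log_kernel_reg nu X mX X2 j (X s) (X2 s).
  + exact: measurableT_comp (measurable_log_kernel X X mX mX X2 X2)
      (pair1_measurable s).
  + by move=> t _; exact: log_kernel_reg_le.
Qed.

(** By the expansion of the kernel, the regularized energy of the signed measure
    mu - nu is the sum over n of r^n / (2 n) times the square of the difference
    of the n-th Chebyshev moments: the constant terms cancel since both measures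
    have mass 1. Keeping a single term and using that r >= 1/2 gives a bound
    which is uniform in the regularization. *)
Lemma reg_energy_positive mu nu j n : (1 <= n)%N ->
  ((2^-1) ^+ n / (2 * n%:R) * (cheb_moment mu X n - cheb_moment nu X n) ^+ 2 <=
   reg_energy j mu mu + reg_energy j nu nu - 2 * reg_energy j mu nu)%R.
Proof.
move=> n1; have := @reg_radius_itv R j => r01.
set r := reg_radius j in r01 *.
have cE := cvg_kernel_error j.
set D := (_ + _ - _)%R.
pose c k := (r ^+ k / (2 * k%:R) * (cheb_moment mu X k - cheb_moment nu X k) ^+ 2)%R.
have c0 k : (0 <= c k)%R.
  have r0 : (0 <= r)%R by lra.
  by rewrite /c mulr_ge0 ?sqr_ge0// mulr_ge0 ?exprn_ge0 ?invr_ge0 ?mulr_ge0 ?ler0n.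
apply: (@le_trans _ _ (c n)).
  rewrite /c ler_wpM2r ?sqr_ge0// ler_wpM2r ?invr_ge0 ?mulr_ge0//.
  by rewrite lerXn2r ?nnegrE; lra.
(* Each of the four regularized energies in D is known up to the error. *)
have cD N : (n <= N)%N -> (c n - 4 * kernel_error j N <= D)%R.
  move=> nN.
  have := reg_energy_approx mu mu j N; have := reg_energy_approx nu nu j N.
  have := reg_energy_approx mu nu j N.
  rewrite !ler_norml -/r.
  set Smn := (\sum_(1 <= n < N.+1) _ * (_ mu X n * _ nu X n))%R.
  set Snn := (\sum_(1 <= n < N.+1) _ * (_ nu X n * _ nu X n))%R.
  set Smm := (\sum_(1 <= n < N.+1) _ * (_ mu X n * _ mu X n))%R.
  move=> Emn Enn Emm.
  have : (c n <= Smm + Snn - 2 * Smn)%R.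
    rewrite /Smm /Snn /Smn mulr_sumr -big_split -sumrB/=.
    rewrite (eq_bigr c); last by move=> k _; rewrite /c; ring.
    rewrite (bigD1_seq n) ?mem_index_iota ?n1 ?ltnS ?iota_uniq//=.
    by rewrite lerDl sumr_ge0.
  rewrite /D; lra.
have cl : (c n - 4 * kernel_error j N)%R @[N --> \oo] --> (c n - 4 * 0)%R.
  by apply: cvgB; [exact: cvg_cst|apply: cvgM; [exact: cvg_cst|]].
rewrite mulr0 subr0 in cl.
apply: (cvgr_to_le cl).
by exists n.
Qed.

(** If the energy of mu - nu is nonpositive then all its Chebyshev moments
    vanish. The regularized energies approach the self-energies from below, so
    the uniform lower bound passes to the limit with only the cross term needing
    convergence. *)
Theorem energy_separates mu nu : energy mu nu < +oo ->
  energy mu mu + energy nu nu <= energy mu nu + energy mu nu ->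
  forall n, cheb_moment mu X n = cheb_moment nu X n.
Proof.
move=> Ifin Ile [|n].
  by rewrite /cheb_moment /=; rewrite !Rintegral_prob_cst.
set delta := ((2^-1) ^+ n.+1 / (2 * n.+1%:R) *
  (cheb_moment mu X n.+1 - cheb_moment nu X n.+1) ^+ 2)%R.
have I0 : 0 <= energy mu nu.
  apply: integral_ge0 => s _; apply: integral_ge0 => t _.
  exact: log_kernel_ge0.
have If : energy mu nu \is a fin_num by rewrite ge0_fin_numE.
have cI := cvg_energy mu nu.
move: Ile If cI; case: (energy mu nu) => // I Ile _ cI.
have cIr : reg_energy j mu nu @[j --> \oo] --> I by case/fine_cvgP : cI.
have dle j : (2 * reg_energy j mu nu <= I + I - delta)%R.
  have := reg_energy_positive mu nu j n.+1 isT; rewrite -/delta.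
  have : (reg_energy j mu mu)%:E + (reg_energy j nu nu)%:E <= (I + I)%:E.
    by rewrite EFinD (le_trans _ Ile)// leeD// reg_energy_le.
  rewrite -EFinD lee_fin; lra.
have : (2 * I <= I + I - delta)%R.
  have c2 : (2 * reg_energy j mu nu)%R @[j --> \oo] --> (2 * I)%R.
    by apply: cvgM; first exact: cvg_cst.
  by apply: (cvgr_to_le c2); exact: nearW.
move=> d0; have : (delta <= 0)%R by lra.
rewrite /delta pmulr_rle0 ?mulr_gt0 ?exprn_gt0 ?invr_gt0 ?mulr_gt0 ?ltr0n//.
move=> sq0; have /eqP : ((cheb_moment mu X n.+1 - cheb_moment nu X n.+1) ^+ 2 = 0)%R.
  by apply/eqP; rewrite eq_le sq0 sqr_ge0.
by rewrite sqrf_eq0 subr_eq0 => /eqP.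
Qed.

End OneSpace.

End Energy.

(** * The arcsine distribution *)

Section Arcsine.
Context {R : realType}.

Definition unit_uniform : probability (measurableTypeR R) R :=
  uniform_prob (@ltr01 R).

Lemma sin_natpi n : sin (n%:R * pi : R) = 0.
Proof.
elim: n => [|n IH]; first by rewrite mul0r sin0.
by rewrite -natr1 mulrDl mul1r sinDpi IH oppr0.
Qed.

Lemma measurable_cosM (c : R) : measurable_fun setT (fun t : R => cos (c * t)).
Proof.
apply: continuous_measurable_fun => t.
apply: continuous_comp; first exact: mulrl_continuous.
exact: continuous_cos.
Qed.

Lemma integral_unit_uniform_cos n : (0 < n)%N ->
  \int[unit_uniform]_t cos (n%:R * pi * t) = 0 :> R.
Proof.
move=> n0; set c : R := n%:R * pi.
have c0 : c != 0 by rewrite mulf_neq0 ?pnatr_eq0 -?lt0n// gt_eqF ?pi_gt0.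
have ci : unit_uniform.-integrable setT (EFin \o (fun t : R => cos (c * t))).
  apply: (@bounded_integrable _ _ _ unit_uniform _ 1); first exact: measurable_cosM.
  by move=> t; rewrite ler_norml cos_geN1 cos_le1.
have oneci := integrable_cst_prob unit_uniform 1.
(* Adding 1 makes the integrand nonnegative. *)
suff : \int[unit_uniform]_t (1 + cos (c * t)) = 1 :> R.
  by rewrite RintegralD// Rintegral_prob_cst => /eqP; rewrite -subr_eq0 addrAC subrr add0r => /eqP.
rewrite /Rintegral integral_uniform; first last.
- by move=> t; rewrite lee_fin -lerBlDl sub0r cos_geN1.
- by apply/measurable_EFinP/measurable_funD => //; exact: measurable_cosM.
pose F (t : R) := t + sin (c * t) / c.
have dF (t : R) : is_derive t (1 : R) F (1 + cos (c * t)).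
  have d1 : is_derive t (1 : R) (fun t => c * t) c.
    rewrite (_ : (fun t => _) = c \*: id)//.
    apply: (@is_derive_eq _ _ _ _ _ _ _ _ (is_deriveZ _ (is_derive_id _ _))).
    by rewrite /GRing.scale/= mulr1.
  rewrite /F (_ : (fun t => _) = id + c^-1 \*: (@sin R \o (fun t => c * t))); last first.
    by apply/funext => s; rewrite !fctE/= /GRing.scale/= mulrC.
  apply: (@is_derive_eq _ _ _ _ _ _ _ _ (is_deriveD (is_derive_id _ _)
    (is_deriveZ _ (is_derive1_comp (is_derive_sin _) d1)))).
  by rewrite /GRing.scale/= mulrC mulfK.
have cF : continuous F.
  by move=> t; apply/differentiable_continuous/derivable1_diffP; case: (dF t).
rewrite (@continuous_FTC2 _ _ F)//.
- rewrite /F mulr1 mulr0 sin0 mul0r sin_natpi mul0r !addr0 subr0 invr1 -EFinB.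
  by rewrite mul1e subr0.
- apply: continuous_subspaceT => t.
  apply: cvgD; first exact: cvg_cst.
  apply: continuous_comp; first exact: mulrl_continuous.
  exact: continuous_cos.
- split.
  + by move=> t _; case: (dF t).
  + by apply: cvg_at_right_filter; exact: cF.
  + by apply: cvg_at_left_filter; exact: cF.
- by move=> t _; rewrite derive1E; case: (dF t).
Qed.

Definition arcsine_map (t : R) : R := 2 * cos (pi * t).

Lemma measurable_arcsine_map : measurable_fun setT arcsine_map.
Proof. by apply: measurable_funM => //; exact: measurable_cosM. Qed.

Lemma arcsine_map_itv t : -2 <= arcsine_map t <= 2.
Proof.
by rewrite /arcsine_map; have := cos_le1 (pi * t); have := cos_geN1 (pi * t); lra.
Qed.

Lemma cheb_moment_arcsine n : (0 < n)%N ->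
  cheb_moment unit_uniform arcsine_map n = 0.
Proof.
move=> n0; rewrite /cheb_moment /arcsine_map.
under eq_Rintegral do rewrite cheb_cos mulrA.
rewrite RintegralZl//; first by rewrite integral_unit_uniform_cos// mulr0.
apply: (@bounded_integrable _ _ _ unit_uniform _ 1); first exact: measurable_cosM.
by move=> t; rewrite ler_norml cos_geN1 cos_le1.
Qed.

Lemma cvg_reg_radius : reg_radius j @[j --> \oo] --> (1 : R).
Proof.
rewrite (_ : (fun j => _) = (fun j => 1 - harmonic j.+1)); last first.
  apply/funext => j; rewrite /reg_radius /=.
  have j0 : (j.+2%:R : R) != 0 by rewrite pnatr_eq0.
  by apply: (mulIf j0); rewrite mulrBl divfK// mulVf// mul1r -[j.+2%:R]natr1 addrK.
rewrite -[X in _ --> X]subr0; apply: cvgB; first exact: cvg_cst.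
have := @cvg_harmonic R; by rewrite -cvg_shiftS.
Qed.

(** The regularized potential is ln 8 + ln r, since every term of order n >= 1 in
    the expansion of the kernel integrates to zero; then r tends to 1. This is
    the evaluation of the integral of log |2 cos u - 2 cos v| over v. *)
Lemma arcsine_potential (x : R) : -2 <= x <= 2 ->
  (\int[unit_uniform]_t log_kernel x (arcsine_map t) = (ln 8)%:E)%E.
Proof.
move=> x2.
have E j : (\int[unit_uniform]_t (log_kernel_reg j x (arcsine_map t))%:E =
    (ln 8 + ln (reg_radius j))%:E)%E.
  rewrite -EFin_Rintegral; last first.
    exact: (integrable_log_kernel_reg unit_uniform _ measurable_arcsine_map arcsine_map_itv j x x2).
  congr EFin; apply/eqP; rewrite -subr_eq0 -normr_le0.
  apply: (cvgr_to_ge (cvg_kernel_error j)); apply: nearW => N.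
  have := reg_potential unit_uniform arcsine_map measurable_arcsine_map
    arcsine_map_itv j N x x2.
  rewrite big_nat big1 ?addr0// => n /andP[n1 _].
  by rewrite cheb_moment_arcsine// mulr0 mul0r.
have := cvg_potential unit_uniform arcsine_map measurable_arcsine_map
  arcsine_map_itv x x2.
under eq_fun do rewrite E.
move=> cp; apply: (cvg_unique _ cp) => //.
apply: cvg_EFin; first exact: nearW.
rewrite -[X in _ --> X](_ : ln 8 + ln 1 = ln 8); last by rewrite ln1 addr0.
apply: cvgD; first exact: cvg_cst.
apply: continuous_cvg; last exact: cvg_reg_radius.
exact: continuous_ln.
Qed.

End Arcsine.

(** * Bounded distributions are determined by their moments *)

Section IndicatorPolynomials.
Context {R : realType}.
Implicit Types (u y : R) (n N : nat).

Lemma bernoulli_le y N : 0 <= y <= 1 -> 1 - N%:R * y <= (1 - y) ^+ N.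
Proof.
move=> /andP[y0 y1]; elim: N => [|N IH]; first by rewrite mul0r subr0 expr0.
rewrite exprS; apply: (@le_trans _ _ ((1 - y) * (1 - N%:R * y))).
  have : 0 <= N%:R * y * y by rewrite !mulr_ge0.
  by rewrite -natr1; lra.
by rewrite ler_wpM2l// subr_ge0.
Qed.

Lemma bernoulli_ge y N : 0 <= y -> 1 + N%:R * y <= (1 + y) ^+ N.
Proof.
move=> y0; elim: N => [|N IH]; first by rewrite mul0r addr0 expr0.
rewrite exprS; apply: (@le_trans _ _ ((1 + y) * (1 + N%:R * y))).
  have : 0 <= N%:R * y * y by rewrite !mulr_ge0.
  by rewrite -natr1; lra.
by rewrite ler_wpM2l// addr_ge0.
Qed.

Lemma expr_1B_le y N : 0 <= y <= 1 -> (1 - y) ^+ N <= (1 + N%:R * y)^-1.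
Proof.
move=> /andP[y0 y1].
have p0 : 0 < 1 + N%:R * y by rewrite ltr_pwDl// mulr_ge0.
rewrite -[leRHS]mul1r ler_pdivlMr//.
apply: (@le_trans _ _ ((1 - y) ^+ N * (1 + y) ^+ N)).
  by rewrite ler_wpM2l ?exprn_ge0 ?subr_ge0// bernoulli_ge.
rewrite -exprMn exprn_ile1//; first by rewrite mulr_ge0//; lra.
have := sqr_ge0 y; lra.
Qed.

Lemma cvg_mulrn_expr (v : R) : 0 <= v < 1 -> n%:R * v ^+ n @[n --> \oo] --> (0 : R).
Proof.
(* The mean w of 1 and v satisfies v <= w^2 by the inequality of arithmetic and
   geometric means, hence n v^n <= (n w^n) w^n, and n w^n stays bounded. *)
move=> /andP[v0 v1]; pose w := (1 + v) / 2.
have w01 : 0 < w < 1 by rewrite /w; lra.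
have vw : v <= w ^+ 2.
  by have := sqr_ge0 (1 - v); rewrite /w; lra.
(* From w (2 - w) <= 1 and Bernoulli's inequality for (1 + (1 - w))^n. *)
have key n : n%:R * w ^+ n <= (1 - w)^-1.
  rewrite -[leRHS]mul1r ler_pdivlMr; last by lra.
  have := @bernoulli_ge (1 - w) n; rewrite subr_ge0 => /(_ (ltW (andP w01).2)) B.
  apply: (@le_trans _ _ (w ^+ n * (1 + (1 - w)) ^+ n)).
    apply: (@le_trans _ _ (w ^+ n * (1 + n%:R * (1 - w)))).
      have : 0 <= w ^+ n by rewrite exprn_ge0//; lra.
      lra.
    by rewrite ler_wpM2l// exprn_ge0//; lra.
  rewrite -exprMn exprn_ile1//; first by rewrite mulr_ge0//; lra.
  have := sqr_ge0 (1 - w); lra.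
apply: (@squeeze_cvgr _ _ _ _ (fun=> 0) (fun n => (1 - w)^-1 * w ^+ n)).
- apply: nearW => n; rewrite mulr_ge0 ?exprn_ge0//=.
  apply: (@le_trans _ _ (n%:R * (w ^+ n * w ^+ n))).
    by rewrite ler_wpM2l// -exprMn -expr2 lerXn2r ?nnegrE ?sqr_ge0.
  by rewrite mulrA ler_wpM2r// exprn_ge0//; lra.
- exact: cvg_cst.
- rewrite -[X in _ --> X](mulr0 (1 - w)^-1); apply: cvgM; first exact: cvg_cst.
  by apply: cvg_expr; rewrite gtr0_norm; lra.
Qed.

(** Polynomials that converge to the indicator function of u < 1/2 on [0, 1].
    The factor n in the exponent is there for the point u = 1/2 itself: with the
    exponent 2^n the limit there would be 1/e, and distributions with an atom
    would need a separate argument. *)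
Definition threshold_poly n u : R := (1 - u ^+ n) ^+ (n * 2 ^ n)%N.

(** Bernoulli's inequality bounds the polynomial from below by
    1 - n (2u)^n and from above by 1 / (1 + n (2u)^n). *)
Lemma cvg_threshold_poly u : 0 <= u <= 1 ->
  threshold_poly n u @[n --> \oo] --> ((u < 2^-1)%R%:R : R).
Proof.
move=> /andP[u0 u1].
have un n : 0 <= u ^+ n <= 1 by rewrite exprn_ge0//= exprn_ile1.
have E n : (n * 2 ^ n)%N%:R * u ^+ n = n%:R * (2 * u) ^+ n :> R.
  by rewrite natrM natrX exprMn mulrA.
have [u2|u2] := ltP u 2^-1.
  apply: (@squeeze_cvgr _ _ _ _ (fun n => 1 - n%:R * (2 * u) ^+ n) (fun=> 1)).
  - apply: nearW => n; rewrite -E bernoulli_le//=.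
    by rewrite exprn_ile1// ?subr_ge0 ?(andP (un n)).2// gerBl (andP (un n)).1.
  - rewrite -[X in _ --> X]subr0; apply: cvgB; first exact: cvg_cst.
    by apply: cvg_mulrn_expr; lra.
  - exact: cvg_cst.
apply: (@squeeze_cvgr _ _ _ _ (fun=> 0) harmonic).
- apply: nearW => n; rewrite exprn_ge0 ?subr_ge0 ?(andP (un n)).2//=.
  apply: le_trans (expr_1B_le _ _ (un n)) _.
  rewrite lef_pV2 ?posrE ?ltr0n//; last first.
    by rewrite ltr_pwDl// mulr_ge0// (andP (un n)).1.
  rewrite E -nat1r lerD2l -[leLHS]mulr1 ler_wpM2l// exprn_ege1//.
  lra.
- exact: cvg_cst.
- exact: cvg_harmonic.
Qed.

End IndicatorPolynomials.

Section Moments.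
Context {R : realType} {d} {T : measurableType d} (X : T -> R).
Hypotheses (mX : measurable_fun setT X) (X2 : forall s, -2 <= X s <= 2).
Implicit Types mu nu : probability T R.

Lemma integrable_exprM_cheb mu k n :
  mu.-integrable setT (EFin \o (fun s => X s ^+ k * cheb n (X s))).
Proof.
apply: (@bounded_integrable _ _ _ mu _ (2 ^+ k * 2)).
  apply: measurable_funM; first exact: measurable_funX.
  have := integrable_cheb mu X mX X2 n.
  by move=> /integrableP[/measurable_EFinP].
move=> s; rewrite normrM ler_pM// ?cheb_bound// normrX lerXn2r ?nnegrE//.
by rewrite ler_norml.
Qed.

Variables (mu nu : probability T R).
Hypothesis mu_nu : forall n, cheb_moment mu X n = cheb_moment nu X n.

(** By induction on the power, with X C_{n+1} = C_{n+2} + C_n. *)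
Lemma exprM_cheb_moment_eq k n :
  \int[mu]_s (X s ^+ k * cheb n (X s)) = \int[nu]_s (X s ^+ k * cheb n (X s)).
Proof.
elim: k n => [|k IH] n.
  under eq_Rintegral do rewrite expr0 mul1r.
  under [RHS]eq_Rintegral do rewrite expr0 mul1r.
  exact: mu_nu.
case: n => [|n].
  have E (m : probability T R) : \int[m]_s (X s ^+ k.+1 * cheb 0 (X s)) =
     2 * \int[m]_s (X s ^+ k * cheb 1 (X s)).
    rewrite -RintegralZl//; last exact: integrable_exprM_cheb.
    by apply: eq_Rintegral => s _; rewrite /= exprS; ring.
  by rewrite !E IH.
have E (m : probability T R) : \int[m]_s (X s ^+ k.+1 * cheb n.+1 (X s)) =
    \int[m]_s (X s ^+ k * cheb n.+2 (X s)) + \int[m]_s (X s ^+ k * cheb n (X s)).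
  rewrite -RintegralD//; try exact: integrable_exprM_cheb.
  by apply: eq_Rintegral => s _; rewrite chebSS exprS; ring.
by rewrite !E !IH.
Qed.

Lemma poly_moment_eq (p : {poly R}) :
  \int[mu]_s p.[X s] = \int[nu]_s p.[X s].
Proof.
have wi (m : probability T R) n : m.-integrable setT (EFin \o (fun s => X s ^+ n.-1)).
  apply: (@bounded_integrable _ _ _ m _ (2 ^+ n.-1)); first exact: measurable_funX.
  by move=> s; rewrite normrX lerXn2r ?nnegrE// ler_norml.
have E s : p.[X s] = 0 + \sum_(1 <= n < (size p).+1) p`_n.-1 * X s ^+ n.-1.
  by rewrite add0r big_add1 horner_coef big_mkord.
under eq_Rintegral do rewrite E.
under [RHS]eq_Rintegral do rewrite E.
have [_ ->] := integrable_lincomb mu 0 (fun n => p`_n.-1)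
  (fun n s => X s ^+ n.-1) (size p) (wi mu).
have [_ ->] := integrable_lincomb nu 0 (fun n => p`_n.-1)
  (fun n s => X s ^+ n.-1) (size p) (wi nu).
congr (_ + _); apply: eq_bigr => n _; congr (_ * _).
have := exprM_cheb_moment_eq n.-1 0 => /=.
rewrite !RintegralZr//; try exact: (wi _ n).
by move=> /mulIf; apply.
Qed.

Lemma cvg_threshold_moment (m : probability T R) c : -2 <= c <= 2 ->
  (\int[m]_s (threshold_poly n (2^-1 - (X s - c) / 8))%:E)%E @[n --> \oo] -->
  m [set s | c < X s].
Proof.
move=> c2; pose u s := 2^-1 - (X s - c) / 8.
have u01 s : 0 <= u s <= 1 by have := X2 s; rewrite /u; lra.
have mu' : measurable_fun setT u.
  by apply: measurable_funB => //; apply: measurable_funM => //; exact: measurable_funB.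
have mS : measurable [set s | c < X s].
  rewrite -[X in measurable X]setTI.
  have -> : [set s | c < X s] = X @^-1` `]c, +oo[%classic.
    by apply/seteqP; split => s /=; rewrite in_itv/= andbT.
  exact: mX.
have -> : m [set s | c < X s] = (\int[m]_s ((u s < 2^-1)%R%:R : R)%:E)%E.
  rewrite (_ : (fun s => _) = (fun s => (\1_[set s | c < X s] s)%:E)); last first.
    apply/funext => s; rewrite indicE; congr ((nat_of_bool _)%:R%:E).
    rewrite /u; apply/idP/idP => [us|]; first by rewrite inE/=; lra.
    by rewrite inE/=; lra.
  by rewrite integral_indic// setIT.
apply: (@dominated_cvg _ _ _ m setT measurableT
  (fun n s => (threshold_poly n (u s))%:E)
  (fun s => ((u s < 2^-1)%R%:R : R)%:E) (cst 1%E)).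
- move=> n; apply/measurable_EFinP/measurable_funX/measurable_funB => //.
  exact: measurable_funX.
- move=> s _; apply: cvg_EFin; first exact: nearW.
  exact: cvg_threshold_poly.
- by [].
- exact: (integrable_cst_prob m 1).
- move=> n s _; rewrite lee_fin.
  have /andP[a0 a1] := u01 s.
  have b1 : u s ^+ n <= 1 by rewrite exprn_ile1.
  by rewrite ger0_norm ?exprn_ge0 ?exprn_ile1 ?subr_ge0// gerBl exprn_ge0.
Qed.

(** The event is {u < 1/2} for u = 1/2 - (X - c)/8, which takes its values in
    [0, 1] because |X - c| <= 4. *)
Lemma moment_distribution_eq c : -2 <= c <= 2 ->
  mu [set s | c < X s] = nu [set s | c < X s].
Proof.
move=> c2.
have E n : (\int[mu]_s (threshold_poly n (2^-1 - (X s - c) / 8))%:E =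
    \int[nu]_s (threshold_poly n (2^-1 - (X s - c) / 8))%:E)%E.
  pose p : {poly R} := (1 - ((2^-1 + c / 8)%:P - 8^-1 *: 'X) ^+ n) ^+ (n * 2 ^ n).
  have pE s : threshold_poly n (2^-1 - (X s - c) / 8) = p.[X s].
    rewrite /p /threshold_poly !hornerE; congr ((1 - _ ^+ _) ^+ _); lra.
  have pi (m : probability T R) : m.-integrable setT (EFin \o (fun s => p.[X s])).
    apply: (@bounded_integrable _ _ _ m _ 1).
      by apply: measurableT_comp => //; apply: continuous_measurable_fun; exact: continuous_horner.
    move=> s; rewrite -pE /threshold_poly; have := X2 s => Xs.
    have u01 : 0 <= 2^-1 - (X s - c) / 8 <= 1 by lra.
    move: (2^-1 - _) u01 => u /andP[a0 a1].
    have b1 : u ^+ n <= 1 by rewrite exprn_ile1.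
    by rewrite ger0_norm ?exprn_ge0 ?exprn_ile1 ?subr_ge0// gerBl exprn_ge0.
  under eq_integral do rewrite pE.
  under [RHS]eq_integral do rewrite pE.
  by rewrite -!EFin_Rintegral// poly_moment_eq.
have := cvg_threshold_moment mu c c2; under eq_fun do rewrite E.
move=> /cvg_unique; apply => //; exact: cvg_threshold_moment.
Qed.

End Moments.

(** * Mixtures of distributions and the energy in a scaled coordinate *)

Section ProbabilityTools.
Context {R : realType}.
Local Open Scope ereal_scope.

Lemma unit_uniformE (A : set R) : measurable A ->
  @unit_uniform R A = lebesgue_measure (A `&` `[0%R, 1%R]).
Proof.
move=> mA; rewrite -[A in LHS]setIT -integral_indic//.
rewrite integral_uniform//; last exact/measurable_EFinP/measurable_indic.
rewrite subr0 invr1 mul1e integral_indic//; exact: measurable_itv.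
Qed.

(** A mixture with equal weights enters later arguments only through its
    integrals, events being the case of indicator functions. *)
Lemma average_distribution d (T : measurableType d) (P : probability T R)
    (n : nat) (f : nat -> T -> R) : (0 < n)%N ->
  (forall i, (i < n)%N -> measurable_fun setT (f i)) ->
  exists mu : probability (measurableTypeR R) R,
    forall g : R -> \bar R, measurable_fun setT g -> (forall x, 0 <= g x) ->
    \int[mu]_x g x = (n%:R^-1)%:E * \sum_(i < n) \int[P]_s g (f i s).
Proof.
move=> n0 mf.
(* A sequence of measures is indexed by all integers, hence the default value
   beyond n. *)
pose f' i : T -> measurableTypeR R := if (i < n)%N then f i else cst 0%R.
have mf' i : @measurable_fun _ _ T (measurableTypeR R) setT (f' i).
  by rewrite /f'; case: ifP => // /mf.
pose F i : {mfun T >-> measurableTypeR R} := HB.pack (f' i)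
  (isMeasurableFun.Build _ _ T (measurableTypeR R) (f' i) (mf' i)).
pose m_ i : {measure set (measurableTypeR R) -> \bar R} := distribution P (F i).
have n_ge0 : (0 <= (n%:R^-1 : R))%R by rewrite invr_ge0.
pose nu : {measure set (measurableTypeR R) -> \bar R} :=
  mscale (NngNum n_ge0) (msum m_ n).
have nuE (g : R -> \bar R) : measurable_fun setT g -> (forall x, 0 <= g x) ->
    \int[nu]_x g x = (n%:R^-1)%:E * \sum_(i < n) \int[P]_s g (f i s).
  move=> mg g0; rewrite ge0_integral_mscale//; congr (_ * _).
  rewrite ge0_integral_measure_sum//; apply: eq_bigr => i _.
  rewrite ge0_integral_pushforward//.
  by apply: eq_integral => s _; rewrite /= /f' ltn_ord.
have nu1 : nu setT = 1.
  have := nuE (cst 1) (measurable_cst _) (fun=> lee01).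
  rewrite integral_cst// mul1e => ->.
  rewrite (eq_bigr (fun=> 1)); last first.
    by move=> i _; rewrite integral_cst// measure_setT mule1.
  rewrite sumEFin big_const_ord iter_addr addr0 -EFinM -[(1 *+ n)%R]/(n%:R)%R mulVf//.
  by rewrite pnatr_eq0 -lt0n.
pose mu : probability (measurableTypeR R) R := HB.pack (Measure.sort nu)
  (Measure_isProbability.Build _ _ _ nu nu1).
by exists mu.
Qed.

Lemma integrable_of_lt_pinfty d (T : measurableType d) (P : probability T R)
  (f : T -> \bar R) : measurable_fun setT f -> (forall x, 0 <= f x) ->
  \int[P]_x f x < +oo -> P.-integrable setT f.
Proof.
move=> mf f0 fi; apply/integrableP; split => //.
by under eq_integral do rewrite gee0_abs//.
Qed.

(** The integral of f may be infinite, in which case additivity for integrable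
    functions does not apply: the negative part of f - c is bounded, hence the
    positive part carries the infinite mass. *)
Lemma integral_subr_cst d (T : measurableType d) (P : probability T R)
    (f : T -> \bar R) (c : R) : measurable_fun setT f -> (forall x, 0 <= f x) ->
  \int[P]_x (f x - c%:E) = \int[P]_x f x - c%:E.
Proof.
move=> mf f0.
have [fi|] := ltP (\int[P]_x f x) +oo.
  rewrite integralB//; last 2 first.
  - exact: integrable_of_lt_pinfty.
  - exact: (integrable_cst_prob P c).
  by rewrite integral_cst// measure_setT mule1.
rewrite leye_eq => /eqP foo; rewrite foo.
have mg : measurable_fun setT (fun x => f x - c%:E) by exact: emeasurable_funB.
rewrite [LHS]integralE.
have neg_fin : \int[P]_x (fun x => f x - c%:E)^\- x < +oo.
  apply: (@le_lt_trans _ _ (\int[P]_x `|c|%:E)).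
    apply: ge0_le_integral => //; first exact: measurable_funeneg.
    move=> x _; rewrite funenegE ge_max lee_fin normr_ge0 andbT.
    have := f0 x; case: (f x) => [r| |]//; last by rewrite leNye.
    by rewrite !lee_fin => r0; have := ler_norm c; lra.
  by rewrite integral_cst// measure_setT mule1 ltry.
have pos_oo : \int[P]_x (fun x => f x - c%:E)^\+ x = +oo.
  apply/eqP; rewrite -leye_eq leNgt; apply/negP => pfin.
  have : \int[P]_x f x <= \int[P]_x ((fun x => f x - c%:E)^\+ x + `|c|%:E).
    apply: ge0_le_integral => //.
      by apply: emeasurable_funD => //; exact: measurable_funepos.
    move=> x _; rewrite funeposE.
    have := f0 x; case: (f x) => [r| |]// _.
    have : (r - c)%:E <= maxe (r%:E - c%:E) 0 by rewrite le_max lexx.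
    move=> /leeD2r - /(_ `|c|%:E); apply: le_trans.
    by rewrite lee_fin; have := ler_norm c; lra.
  rewrite foo ge0_integralD//; last exact: measurable_funepos.
  rewrite integral_cst// measure_setT mule1 leye_eq => /eqP E.
  have : \int[P]_x (fun x => f x - c%:E)^\+ x + `|c|%:E < +oo by rewrite lte_add_pinfty ?ltry.
  by rewrite E ltxx.
rewrite pos_oo.
have : \int[P]_x (fun x => f x - c%:E)^\- x \is a fin_num.
  by rewrite ge0_fin_numE// integral_ge0.
by case: (\int[P]_x _).
Qed.

Lemma prob_eq_integral d (T : measurableType d) (P : probability T R)
    (B : set T) (f g : T -> \bar R) : measurable B -> P B = 1 ->
  measurable_fun setT f -> measurable_fun setT g ->
  (forall x, B x -> f x = g x) -> \int[P]_x f x = \int[P]_x g x.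
Proof.
move=> mB PB mf mg fg; apply: ae_eq_integral => //.
exists (~` B); split; first exact: measurableC.
  transitivity (1 - P B); first exact: probability_setC.
  by rewrite PB subee.
by move=> x /= fgx Bx; apply: fgx => _; exact: fg.
Qed.

Lemma lne_norm_cases (r : R) :
  lne `|r|%:E = if r == 0%R then -oo else (ln `|r|)%:E.
Proof.
have [->|r0] := eqVneq r 0%R; first by rewrite normr0 le0_lneNy.
by rewrite lne_EFin// normr_gt0.
Qed.

Lemma measurable_lne_norm d (T : measurableType d) (f : T -> R) :
  measurable_fun setT f -> measurable_fun setT (fun x => lne `|f x|%:E).
Proof.
move=> mf; under eq_fun do rewrite lne_norm_cases.
apply: measurable_fun_ifT => //.
  exact: measurable_fun_eqr.
apply/measurable_EFinP; apply: (measurableT_comp (@measurable_ln R)).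
exact: measurableT_comp.
Qed.

Lemma lne_normM (x y A B : R) :
  (A%:E - lne `|x|%:E) + (B%:E - lne `|y|%:E) =
  (A + B)%:E - lne `|x * y|%:E.
Proof.
rewrite !lne_norm_cases mulf_eq0.
have [x0|x0] := eqVneq x 0%R; have [y0|y0] := eqVneq y 0%R => //=.
rewrite normrM lnM ?posrE ?normr_gt0// -!EFinB -EFinD; congr EFin; lra.
Qed.

Section LogEnergy.
Variables (B : set (measurableTypeR R)) (X : measurableTypeR R -> R) (H : R).
Hypotheses (mB : measurable B) (H0 : (0 < H)%R).
Hypotheses (mX : measurable_fun setT X) (X2 : forall s, (-2 <= X s <= 2)%R).
Hypothesis XB : forall s, B s -> X s = (s / H)%R.

Let c : R := (ln 8 + ln H)%R.

(** Both the change of unit and the normalization of the kernel only shift the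
    logarithm by a constant. *)
Lemma log_kernel_scale s t : B s -> B t ->
  log_kernel (X s) (X t) = c%:E - lne `|s - t|%:E.
Proof.
move=> Bs Bt; rewrite /log_kernel !XB// -mulrBl !lne_norm_cases.
rewrite mulf_eq0 invr_eq0 (gt_eqF H0) orbF.
case: eqP => [//|/eqP st].
rewrite normrM normfV (gtr0_norm H0) ln_div ?posrE ?normr_gt0//.
by rewrite -!EFinB; congr EFin; rewrite /c; lra.
Qed.

(** Points outside B may be sent anywhere by X, but they are negligible. *)
Lemma log_energyE (nu : probability (measurableTypeR R) R) : nu B = 1 ->
  log_energy nu = energy X nu nu - c%:E.
Proof.
move=> nuB; rewrite /log_energy /energy.
have mL2 : measurable_fun setT (fun z : R * R => - lne `|z.1 - z.2|%:E).
  apply: measurableT_comp => //; apply: measurable_lne_norm.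
  exact: measurable_funB.
have mL s : measurable_fun setT (fun t : R => - lne `|s - t|%:E).
  apply: measurableT_comp => //; apply: measurable_lne_norm.
  exact: measurable_funB.
have mK := measurable_log_kernel X X mX mX X2 X2.
have mKs s : measurable_fun setT (fun t => log_kernel (X s) (X t)).
  exact: measurableT_comp mK (pair1_measurable s).
have mP := @measurable_log_potential R _ _ X mX X2 nu.
rewrite -integral_subr_cst//; last first.
  by move=> s; apply: integral_ge0 => t _; exact: log_kernel_ge0.
apply: (@prob_eq_integral _ _ _ B) => //.
- under eq_fun do rewrite integralE.
  have mpos : measurable_fun setT (fun z : R * R => (fun z => - lne `|z.1 - z.2|%:E)^\+ z).
    exact: measurable_funepos.
  have mneg : measurable_fun setT (fun z : R * R => (fun z => - lne `|z.1 - z.2|%:E)^\- z).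
    exact: measurable_funeneg.
  apply: emeasurable_funB.
    have := @measurable_fun_fubini_tonelli_F _ _ (measurableTypeR R) (measurableTypeR R) R nu _ mpos.
    move=> /(_ (fun z => funepos_ge0 _ z)).
    rewrite /fubini_F; congr measurable_fun; apply/funext => s.
    by apply: eq_integral => t _; rewrite !funeposE.
  have := @measurable_fun_fubini_tonelli_F _ _ (measurableTypeR R) (measurableTypeR R) R nu _ mneg.
  move=> /(_ (fun z => funeneg_ge0 _ z)).
  rewrite /fubini_F; congr measurable_fun; apply/funext => s.
  by apply: eq_integral => t _; rewrite !funenegE.
- exact: emeasurable_funB.
- move=> s Bs; rewrite -integral_subr_cst//; last by move=> t; exact: log_kernel_ge0.
  apply: (@prob_eq_integral _ _ _ B) => //.
  - exact: mL.
  - by apply: emeasurable_funB; [exact: mKs|exact: measurable_cst].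
  - move=> t Bt; rewrite log_kernel_scale// lne_norm_cases.
    by case: ifP => _ //; rewrite -!EFinB -EFinN; congr EFin; lra.
Qed.

End LogEnergy.

End ProbabilityTools.

(** * Transfer matrices *)

Lemma sum_ord2 (V : nmodType) (F : 'I_2 -> V) : \sum_(i < 2) F i = F 0 + F 1.
Proof. by rewrite big_ord_recl big_ord1; congr (_ + F _); exact/val_inj. Qed.

Section TransferMatrix.
Context {R : realType}.
Variables (a b : nat -> R).
Implicit Types (n k : nat).

Notation T := (transfer_matrix a b).

Lemma transfer_matrixS0 n (j : 'I_2) :
  T n.+1 0 j = (a n.+1)^-1 *: (('X - (b n.+1)%:P) * T n 0 j - a n *: T n 1 j).
Proof.
rewrite /= mxE sum_ord2 /one_step_matrix !mxE /= -!mul_polyC.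
ring.
Qed.

Hypothesis a_gt0 : forall n, (0 < n)%N -> 0 < a n.

Lemma transfer_matrixS1 n (j : 'I_2) : T n.+1 1 j = T n 0 j.
Proof.
rewrite /= mxE sum_ord2 /one_step_matrix !mxE /= mulr0 mul0r addr0.
by rewrite -polyCM mulVf ?mul1r// gt_eqF// a_gt0.
Qed.

(** The first column of the transfer matrix propagates the initial condition
    p_0 = 1, p_{-1} = 0. *)
Lemma transfer_matrix_orthonormal n :
  T n 0 0 = orthonormal_poly a b n /\
  T n 1 0 = if n is n1.+1 then orthonormal_poly a b n1 else 0.
Proof.
elim: n => [|n [IH0 IH1]]; first by rewrite !mxE.
rewrite transfer_matrixS1 transfer_matrixS0 IH0 IH1; split=> //.
Qed.

Lemma size_orthonormal_poly n : size (orthonormal_poly a b n) = n.+1.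
Proof.
suff H k : (k <= n)%N -> size (orthonormal_poly a b k) = k.+1 by exact: H.
elim: n k => [|n IH] k; first by rewrite leqn0 => /eqP->; rewrite size_poly1.
rewrite leq_eqVlt ltnS => /orP[/eqP->|]; last exact: IH.
have an0 : (a n.+1)^-1 != 0 by rewrite invr_eq0 gt_eqF// a_gt0.
rewrite /= size_scale//.
have s1 : size (('X - (b n.+1)%:P) * orthonormal_poly a b n) = n.+2.
  by rewrite size_monicM ?monicXsubC ?size_XsubC ?IH// -size_poly_eq0 IH.
rewrite size_polyDl s1// size_polyN (leq_ltn_trans (size_scale_leq _ _))//.
case: n IH {an0 s1} => [|n] IH; first by rewrite size_poly0.
by rewrite IH.
Qed.

(** The second column has lower degree than the first, so that the trace has the
    degree of p_n. *)
Lemma size_transfer_matrix_col1 n :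
  (size (T n 0%R 1%R) <= n)%N /\ (size (T n 1%R 1%R) <= n.-1.+1)%N.
Proof.
elim: n => [|n [IH0 IH1]]; first by rewrite !mxE size_poly0 size_poly1.
rewrite transfer_matrixS1 transfer_matrixS0; split; last exact: leq_trans IH0 _.
apply: leq_trans (size_scale_leq _ _) _.
apply: leq_trans (size_polyD _ _) _; rewrite size_polyN geq_max; apply/andP; split.
  apply: leq_trans (size_polyMleq _ _) _.
  by rewrite size_XsubC.
apply: leq_trans (size_scale_leq _ _) _; apply: leq_trans IH1 _.
by rewrite ltnS leq_pred.
Qed.

Lemma size_discriminant p : (0 < p)%N -> size (discriminant p a b) = p.+1.
Proof.
move=> p0; rewrite /discriminant /mxtrace sum_ord2.
have [-> _] := transfer_matrix_orthonormal p.
rewrite size_polyDl size_orthonormal_poly//.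
have [_ s1] := size_transfer_matrix_col1 p.
by apply: leq_ltn_trans s1 _; rewrite prednK.
Qed.

Lemma transfer_matrix_det n : 0 < a 0%N ->
  T n 0 0 * T n 1 1 - T n 0 1 * T n 1 0 = (a 0%N / a n)%:P.
Proof.
move=> a00; elim: n => [|n IH].
  by rewrite !mxE/= divff ?gt_eqF//; ring.
have an : a n != 0 by rewrite gt_eqF//; case: (n) => // k; exact: a_gt0.
have an1 : a n.+1 != 0 by rewrite gt_eqF// a_gt0.
rewrite !transfer_matrixS1 !transfer_matrixS0 -!mul_polyC.
transitivity (((a n.+1)^-1 * a n)%:P * (T n 0 0 * T n 1 1 - T n 0 1 * T n 1 0)).
  by rewrite polyCM; ring.
rewrite IH -polyCM; congr (_%:P); field.
by rewrite an an1.
Qed.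

Variable p : nat.
Hypothesis p_gt0 : (0 < p)%N.
Hypotheses (a_per : forall n, (0 < n)%N -> a (n + p)%N = a n)
  (b_per : forall n, (0 < n)%N -> b (n + p)%N = b n) (a_0 : a 0%N = a p).

Notation D := (discriminant p a b).

Lemma one_step_matrix_periodic k :
  one_step_matrix a b (k + p) = one_step_matrix a b k.
Proof.
rewrite /one_step_matrix -addSn a_per// b_per//.
by case: k => [|k]; [rewrite -[(0 + p)%N]/p a_0|rewrite a_per].
Qed.

Lemma transfer_matrixDp n : T (n + p)%N = T n *m T p.
Proof.
elim: n => [|n IH]; first by rewrite add0n mul1mx.
by rewrite addSn /= IH one_step_matrix_periodic mulmxA.
Qed.

(** The Cayley-Hamilton identity for a 2 x 2 matrix of determinant 1, restricted
    to the first column. *)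
Lemma transfer_matrix_cayley_hamilton i : (T p *m T p) i 0 = D * T p i 0 - (i == 0)%:R.
Proof.
have a00 : 0 < a 0%N by rewrite a_0 a_gt0.
have ap : a p != 0 by rewrite gt_eqF// a_gt0.
have := transfer_matrix_det p a00; rewrite a_0 divff// polyC1 => det1.
rewrite mxE sum_ord2 /discriminant /mxtrace sum_ord2.
case: (unliftP 0 i) => [j ->|->]; last first.
  rewrite eqxx mulr1n -det1; ring.
have -> : lift 0 j = 1 by apply/val_inj; case: j => -[].
by rewrite /=; ring.
Qed.

(** Chebyshev polynomials of the second kind, with the variable 2 cos u and the
    index shifted: chebU m (2 cos u) = sin(m u) / sin u. *)
Fixpoint chebU m : {poly R} :=
  match m with
  | 0 => 0
  | 1 => 1
  | m1.+1 => if m1 is m2.+1 then 'X * chebU m1 - chebU m2 else 1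
  end.

Lemma chebUSS m : chebU m.+2 = 'X * chebU m.+1 - chebU m.
Proof. by []. Qed.

(** Periodicity makes the transfer matrix over m periods the m-th power of the
    one over a single period, and the powers of a matrix of determinant 1
    satisfy the recurrence of the polynomials chebU evaluated at the trace. *)
Lemma transfer_matrix_pow m :
  T (m * p)%N 1 0 = (chebU m \Po D) * T p 1 0.
Proof.
suff [] : T (m * p)%N 1 0 = (chebU m \Po D) * T p 1 0 /\
          T (m.+1 * p)%N 1 0 = (chebU m.+1 \Po D) * T p 1 0 by [].
elim: m => [|m [IH1 IH2]].
  by rewrite mul0n mul1n comp_poly0 mul0r mxE/= comp_polyC mul1r.
split=> //; rewrite chebUSS rmorphB rmorphM/= comp_polyX mulrBl -mulrA -IH1 -IH2.
have -> : (m.+2 * p = m * p + p + p)%N by lia.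
have -> : (m.+1 * p = m * p + p)%N by lia.
rewrite !transfer_matrixDp -mulmxA !mxE !sum_ord2 !transfer_matrix_cayley_hamilton ?mxE/=.
by ring.
Qed.

Lemma orthonormal_poly_factor m : (0 < m)%N ->
  orthonormal_poly a b (m * p).-1 = (chebU m \Po D) * orthonormal_poly a b p.-1.
Proof.
move=> m0.
have E n : (0 < n)%N -> orthonormal_poly a b n.-1 = T n 1 0.
  by case: n => // n _; have [_ ->] := transfer_matrix_orthonormal n.+1.
by rewrite !E ?muln_gt0 ?m0// transfer_matrix_pow.
Qed.

Lemma dirichletP (t : R) :
  is_dirichlet_point p a b t <-> root (orthonormal_poly a b p.-1) t.
Proof.
have E : T p 1 0 = orthonormal_poly a b p.-1.
  by have [_ ->] := transfer_matrix_orthonormal p; case: (p) p_gt0.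
have Z i : (map_mx (horner_eval t) (T p) *m delta_mx 0 0 : 'cV[R]_2) i 0 = (T p i 0).[t].
  by rewrite mxE sum_ord2 !mxE/= mulr1 mulr0 addr0.
rewrite rootE -E; split=> [[l /matrixP/(_ 1 0)]|/eqP r0].
  by rewrite Z !mxE/= mulr0 => ->.
exists (T p 0 0).[t]; apply/matrixP => i j; rewrite !ord1 Z.
case: (unliftP 0 i) => [k ->|->]; last by rewrite !mxE/= mulr1.
have -> : lift 0 k = 1 by apply/val_inj; case: k => -[].
by rewrite r0 !mxE/= mulr0.
Qed.

End TransferMatrix.

(** * Bands and the equilibrium measure *)

Section RealRoots.
Context {R : realType}.
Implicit Types (f : {poly R}) (rs : seq R).

Lemma complex_root_real f (t : R) :
  root (map_poly (real_complex R) f) t%:C = root f t.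
Proof. exact: fmorph_root. Qed.

(** The factorization over the reals remains one over the complex numbers. *)
Lemma complex_roots_prod f rs : size f = (size rs).+1 -> all (root f) rs ->
  uniq rs -> forall z : R[i],
  root (map_poly (real_complex R) f) z <-> exists2 r, r \in rs & z = r%:C.
Proof.
move=> sf rf urs z.
have fE : f = lead_coef f *: \prod_(r <- rs) ('X - r%:P).
  by apply: all_roots_prod_XsubC => //; rewrite uniq_rootsE.
have l0 : lead_coef f != 0 by rewrite lead_coef_eq0 -size_poly_eq0 sf.
split=> [|[r rrs ->]]; last by rewrite complex_root_real (allP rf).
rewrite fE map_polyZ rootZ ?fmorph_eq0//= map_prod_XsubC.
rewrite -(big_map (real_complex R) xpredT (fun w => 'X - w%:P)) root_prod_XsubC.
by move=> /mapP[r rrs ->]; exists r.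
Qed.

(** The Laguerre expression f'^2 - f f''; where f does not vanish it is - f^2
    times the derivative of f'/f. *)
Definition laguerre f (t : R) : R := f^`().[t] ^+ 2 - f.[t] * f^`()^`().[t].

Lemma laguerre_XsubC (r : R) f t :
  laguerre (('X - r%:P) * f) t = f.[t] ^+ 2 + (t - r) ^+ 2 * laguerre f t.
Proof.
have dX g : (('X - r%:P) * g)^`() = g + ('X - r%:P) * g^`().
  by rewrite derivM derivXsubC mul1r.
rewrite /laguerre dX derivD dX !(hornerXsubC, hornerD, hornerM); ring.
Qed.

(** For a real-rooted f, f'/f is a sum of functions 1/(t - r), all of negative
    derivative. *)
Lemma laguerre_prod_gt0 rs t : (0 < size rs)%N ->
  (\prod_(r <- rs) ('X - r%:P)).[t] != 0 ->
  0 < laguerre (\prod_(r <- rs) ('X - r%:P)) t.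
Proof.
elim: rs => // r rs IH _; rewrite big_cons hornerM mulf_eq0 negb_or => /andP[tr ft].
rewrite laguerre_XsubC.
apply: ltr_pwDl; first by rewrite exprn_even_gt0.
case: rs IH ft => [|r' rs] IH ft.
  by rewrite big_nil /laguerre derivC deriv0 !hornerC expr0n/= mulr0 subr0 mulr0.
by rewrite mulr_ge0 ?sqr_ge0// ltW// IH.
Qed.

Lemma laguerre_gt0 (k : R) rs t : k != 0 -> (0 < size rs)%N ->
  (k *: \prod_(r <- rs) ('X - r%:P)).[t] != 0 ->
  0 < laguerre (k *: \prod_(r <- rs) ('X - r%:P)) t.
Proof.
move=> k0 rs0; rewrite hornerZ mulf_eq0 negb_or => /andP[_ ft].
rewrite /laguerre !derivZ !hornerZ.
rewrite [ltRHS](_ : _ = k ^+ 2 * laguerre (\prod_(r <- rs) ('X - r%:P)) t); last first.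
  by rewrite /laguerre; ring.
by rewrite mulr_gt0 ?exprn_even_gt0// laguerre_prod_gt0.
Qed.

End RealRoots.

Lemma poly_ivt_between {R : rcfType} (f : {poly R}) (s t v : R) :
  f.[s] <= v <= f.[t] ->
  exists2 u, Num.min s t <= u <= Num.max s t & f.[u] = v.
Proof.
move=> fv; have [st|ts] := leP s t.
  have [u ut] := @poly_ivt _ (f - v%:P) s t st ltac:(rewrite !hornerE; lra).
  by rewrite rootE !hornerE subr_eq0 => /eqP fu; exists u.
have [u ut] := @poly_ivt _ (v%:P - f) t s (ltW ts) ltac:(rewrite !hornerE; lra).
by rewrite rootE !hornerE subr_eq0 => /eqP fu; exists u.
Qed.

Section Bands.
Context {R : realType}.
Variables (p : nat) (D : {poly R}) (alpha beta : nat -> R).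
Hypothesis p_gt0 : (0 < p)%N.
Hypothesis size_D : size D = p.+1.
Hypothesis band_lt : forall j, (1 <= j <= p)%N -> alpha j < beta j.
Hypothesis gap_le : forall j, (1 <= j < p)%N -> beta j <= alpha j.+1.
Hypothesis bandsP : forall z : R[i],
  (exists2 c : R, -2 < c < 2 & (map_poly (real_complex R) D).[z] = c%:C) <->
  (exists2 j, (1 <= j <= p)%N & exists2 t : R, alpha j < t < beta j & z = t%:C).

Lemma band_mono i j : (1 <= i)%N -> (i < j)%N -> (j <= p)%N -> beta i <= alpha j.
Proof.
move=> i1; elim: j => // j IH; rewrite ltnS leq_eqVlt => /orP[/eqP<-|ij] jp.
  by apply: gap_le; rewrite i1.
have j1 : (1 <= j)%N by apply: leq_trans i1 (ltnW ij).
apply: le_trans (IH ij (ltnW jp)) _.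
apply: (@le_trans _ _ (beta j)); first by rewrite ltW// band_lt// j1 ltnW.
by apply: gap_le; rewrite j1.
Qed.

Lemma band_interiorP (t : R) :
  -2 < D.[t] < 2 <-> exists2 j, (1 <= j <= p)%N & alpha j < t < beta j.
Proof.
split=> [Dt|[j jp tj]].
  have [] := (bandsP t%:C).1.
    by exists D.[t] => //; rewrite horner_map.
  by move=> j jp [s sj /complexI ->]; exists j.
have [c c2] : exists2 c : R, -2 < c < 2 & (map_poly (real_complex R) D).[t%:C] = c%:C.
  by apply/bandsP; exists j => //; exists t.
by rewrite horner_map => /complexI ->.
Qed.

(** All complex solutions of D = c are real, because the preimage of (-2, 2)
    consists of real intervals. *)
Lemma band_real_rooted (c : R) : -2 < c < 2 -> exists rs : seq R,
  D - c%:P = lead_coef D *: \prod_(r <- rs) ('X - r%:P).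
Proof.
move=> c2; pose f := map_poly (real_complex R) (D - c%:P).
have sD : (size (- c%:P)%R < size D)%N.
  by rewrite size_D size_polyN (leq_ltn_trans (size_polyC_leq1 _)).
have lD : lead_coef (D - c%:P) = lead_coef D by rewrite lead_coefDl.
have [zs fE] := closed_field_poly_normal f.
have f0 : lead_coef f != 0.
  rewrite lead_coef_map fmorph_eq0 lD lead_coef_eq0 -size_poly_eq0 size_D//.
have zsr (z : R[i]) : z \in zs -> z = (complex.Re z)%:C.
  move=> zzs; have /rootP fz : root f z by rewrite fE rootZ// root_prod_XsubC.
  have [] := (bandsP z).1.
    exists c => //; move: fz; rewrite /f rmorphB/= map_polyC hornerD hornerN hornerC/=.
    by move=> /eqP; rewrite subr_eq0 => /eqP.
  by move=> j _ [t _ ->].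
exists (map (@complex.Re R) zs).
apply: (@map_poly_inj _ _ (real_complex R)).
rewrite -/f [LHS]fE map_polyZ lead_coef_map lD map_prod_XsubC big_map/=; congr (_ *: _).
by rewrite !big_seq; apply: eq_bigr => z /zsr {1}->.
Qed.

(** At a critical point t of D, the Laguerre inequality for D - c reads
    (D(t) - c) D''(t) < 0. It holds for values of c on both sides of D(t), which
    is absurd. *)
Lemma deriv_band_neq0 (t : R) : -2 < D.[t] < 2 -> D^`().[t] != 0.
Proof.
move=> Dt; apply/eqP => D'0.
have L c : -2 < c < 2 -> c != D.[t] -> 0 < - ((D.[t] - c) * D^`()^`().[t]).
  move=> c2 cD; have [rs rsE] := band_real_rooted c c2.
  have l0 : lead_coef D != 0 by rewrite lead_coef_eq0 -size_poly_eq0 size_D.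
  have srs : (0 < size rs)%N.
    case: rs rsE => // /(congr1 (fun q : {poly R} => size q)).
    rewrite big_nil size_scale// size_poly1 size_polyDl ?size_D.
      by move=> [p0]; move: p_gt0; rewrite p0.
    by rewrite size_polyN (leq_ltn_trans (size_polyC_leq1 _)).
  have := @laguerre_gt0 R (lead_coef D) rs t l0 srs; rewrite -rsE.
  rewrite hornerD hornerN hornerC subr_eq0 eq_sym => /(_ cD).
  rewrite /laguerre derivB derivC subr0 D'0 expr0n/= sub0r.
  by rewrite hornerD hornerN hornerC.
(* The midpoints between D(t) and the two ends of (-2, 2). *)
have L1 := L ((D.[t] - 2) / 2); have L2 := L ((D.[t] + 2) / 2).
have := L1 ltac:(lra) ltac:(by rewrite lt_eqF//; lra).
have := L2 ltac:(lra) ltac:(by rewrite gt_eqF//; lra).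
move: (D^`()^`().[t]) => d.
set e1 := D.[t] - _; set e2 := D.[t] - _.
have : e1 < 0 by rewrite /e1; lra.
have : 0 < e2 by rewrite /e2; lra.
by nra.
Qed.

Section OneBand.
Variable j : nat.
Hypothesis j_p : (1 <= j <= p)%N.

Lemma band_disc_lt t : alpha j < t < beta j -> -2 < D.[t] < 2.
Proof. by move=> tj; apply/band_interiorP; exists j. Qed.

Lemma band_inj s t : alpha j <= s <= beta j -> alpha j <= t <= beta j ->
  D.[s] = D.[t] -> s = t.
Proof.
wlog st : s t / s < t.
  move=> H sj tj E; have [st|st|//] := ltgtP s t; first exact: H.
  by apply/esym; exact: H.
move=> sj tj E.
have [c] : exists2 c, c \in `]s, t[%R & is_derive c 1 (horner D) 0.
  apply: Rolle => //.
  by apply: continuous_subspaceT; exact: continuous_horner.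
rewrite in_itv/= => sct [_]; rewrite derive_val => D0.
have := @deriv_band_neq0 c; rewrite D0 eqxx => H.
by have /H : -2 < D.[c] < 2 by apply: band_disc_lt; lra.
Qed.

Lemma band_disc_le t : alpha j <= t <= beta j -> -2 <= D.[t] <= 2.
Proof.
move=> tj; have ab := band_lt j j_p.
(* If D left [-2, 2] at t, it would take the value 2 or -2 strictly between t and
   the midpoint s, that is, inside the band. *)
pose s := (alpha j + beta j) / 2.
have Ds : -2 < D.[s] < 2 by apply: band_disc_lt; rewrite /s; lra.
have sj : alpha j < s < beta j by rewrite /s; lra.
apply/andP; split; rewrite leNgt; apply/negP => Dt.
  have [u ut Du] := poly_ivt_between D t s (-2) ltac:(lra).
  have us : u != s by apply/eqP => E; move: Ds; rewrite -E Du; lra.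
  have ut' : u != t by apply/eqP => E; move: Dt; rewrite -E Du; lra.
  have : -2 < D.[u] < 2.
    apply: band_disc_lt.
    by move: ut; rewrite minEle maxEle; case: ifP => ?; move: us ut'; rewrite !neq_lt; lra.
  by rewrite Du; lra.
have [u ut Du] := poly_ivt_between D s t 2 ltac:(lra).
have us : u != s by apply/eqP => E; move: Ds; rewrite -E Du; lra.
have ut' : u != t by apply/eqP => E; move: Dt; rewrite -E Du; lra.
have : -2 < D.[u] < 2.
  apply: band_disc_lt.
  by move: ut; rewrite minEle maxEle; case: ifP => ?; move: us ut'; rewrite !neq_lt; lra.
by rewrite Du; lra.
Qed.

(** The open bands are disjoint, so an edge of one lies in none of them. *)
Lemma band_edge_not_interior t : t = alpha j \/ t = beta j -> ~ -2 < D.[t] < 2.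
Proof.
have ab := band_lt j j_p; have /andP[j1 jp] := j_p.
move=> tj /band_interiorP[i /andP[i1 ip] ti].
have abi := band_lt i ltac:(by rewrite i1).
have [ij|ji|E] := ltngtP i j.
- by have := band_mono i j i1 ij jp; case: tj ti => ->; lra.
- by have := band_mono j i j1 ji ip; case: tj ti => ->; lra.
- by move: ti; rewrite E; case: tj => ->; lra.
Qed.

(** The sign of D at the right edge: 1 if D increases from -2 to 2 on the band, and
    -1 if it decreases from 2 to -2. *)
Definition band_sign : R := D.[beta j] / 2.

Lemma band_signP : (band_sign = 1 \/ band_sign = -1) /\
  D.[beta j] = 2 * band_sign /\ D.[alpha j] = - 2 * band_sign.
Proof.
have ab := band_lt j j_p.
have A := band_edge_not_interior (alpha j) (or_introl erefl).
have B := band_edge_not_interior (beta j) (or_intror erefl).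
have A2 := band_disc_le (alpha j) ltac:(lra).
have B2 := band_disc_le (beta j) ltac:(lra).
(* The values at the edges are 2 or -2, and they differ by injectivity. *)
have AE : D.[alpha j] = 2 \/ D.[alpha j] = -2.
  have [lt2|ge2] := ltP (-2) D.[alpha j]; last by right; lra.
  have [lt2'|ge2'] := ltP D.[alpha j] 2; last by left; lra.
  by case: A; lra.
have BE : D.[beta j] = 2 \/ D.[beta j] = -2.
  have [lt2|ge2] := ltP (-2) D.[beta j]; last by right; lra.
  have [lt2'|ge2'] := ltP D.[beta j] 2; last by left; lra.
  by case: B; lra.
have AB : D.[alpha j] != D.[beta j].
  apply/eqP => /(band_inj (alpha j) (beta j) ltac:(lra) ltac:(lra)); lra.
rewrite /band_sign; case: AE BE AB => -> [] -> /eqP AB.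
- by case: AB.
- by split; [right; lra|split; lra].
- by split; [left; lra|split; lra].
- by case: AB.
Qed.

(** An injective polynomial on an interval is monotone: otherwise the
    intermediate value theorem would produce a second preimage. *)
Lemma band_ltE s t : alpha j <= s <= beta j -> alpha j <= t <= beta j ->
  (s < t) = (band_sign * D.[s] < band_sign * D.[t]).
Proof.
have [S [Db Da]] := band_signP.
have ab := band_lt j j_p.
have H u v : alpha j <= u <= beta j -> alpha j <= v <= beta j -> u < v ->
    band_sign * D.[u] < band_sign * D.[v].
  move=> uj vj uv; rewrite ltNge; apply/negP => Dvu.
  have Dv := band_disc_le v vj.
  have [w wu Dw] : exists2 w, alpha j <= w <= u & D.[w] = D.[v].
    case: S => S; rewrite S in Dvu Da.
      have [w wu Dw] := poly_ivt_between D (alpha j) u D.[v] ltac:(lra).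
      by exists w => //; move: wu; rewrite minEle maxEle; case: ifP => ?; lra.
    have [w wu Dw] := poly_ivt_between D u (alpha j) D.[v] ltac:(lra).
    by exists w => //; move: wu; rewrite minEle maxEle; case: ifP => ?; lra.
  by have := band_inj w v ltac:(lra) vj Dw; lra.
move=> sj tj; have [st|ts|->] := ltgtP s t.
- by rewrite H.
- by apply/esym/negbTE; rewrite -leNgt ltW// H.
- by rewrite ltxx.
Qed.

(** The inverse of D on the j-th band; the default value alpha j only serves
    arguments outside [-2, 2]. *)
Definition band_point (v : R) : R :=
  xget (alpha j) [set t | alpha j <= t <= beta j /\ D.[t] = v].

Lemma band_pointP v : -2 <= v <= 2 ->
  alpha j <= band_point v <= beta j /\ D.[band_point v] = v.
Proof.
move=> v2; rewrite /band_point; apply: (@xgetPex _ (alpha j)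
  [set t | alpha j <= t <= beta j /\ D.[t] = v]).
have ab := band_lt j j_p; have [S [Db Da]] := band_signP.
case: S => S; rewrite S in Db Da.
  have [w wu Dw] := poly_ivt_between D (alpha j) (beta j) v ltac:(lra).
  by exists w; split => //; move: wu; rewrite minEle maxEle; case: ifP => ?; lra.
have [w wu Dw] := poly_ivt_between D (beta j) (alpha j) v ltac:(lra).
by exists w; split => //; move: wu; rewrite minEle maxEle; case: ifP => ?; lra.
Qed.

Lemma band_point_interior v : -2 < v < 2 -> alpha j < band_point v < beta j.
Proof.
move=> v2; have [bj Dv] := band_pointP v ltac:(lra).
have [A B] : band_point v != alpha j /\ band_point v != beta j.
  by split; apply/eqP => E; apply: (band_edge_not_interior (band_point v));
    [left|rewrite Dv|right|rewrite Dv].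
by move: A B; rewrite !neq_lt; lra.
Qed.

Lemma band_point_unique v t : alpha j <= t <= beta j -> D.[t] = v ->
  t = band_point v.
Proof.
move=> tj Dt; have v2 := band_disc_le t tj; rewrite Dt in v2.
have [bj Dv] := band_pointP v v2.
by apply: band_inj => //; rewrite Dt.
Qed.

End OneBand.

Lemma band_points_lt i j v : (1 <= i)%N -> (i < j)%N -> (j <= p)%N ->
  -2 < v < 2 -> band_point i v < band_point j v.
Proof.
move=> i1 ij jp v2.
have bi := band_point_interior i ltac:(by rewrite i1 (leq_trans (ltnW ij))) v v2.
have bj := band_point_interior j ltac:(by rewrite jp (leq_trans i1 (ltnW ij))) v v2.
by have := band_mono i j i1 ij jp; lra.
Qed.

Definition band_points v : seq R := [seq band_point i v | i <- iota 1 p].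

Lemma mem_band_points v r : reflect (exists2 i, (1 <= i <= p)%N & r = band_point i v)
  (r \in band_points v).
Proof.
apply: (iffP mapP) => -[i ip ->]; exists i => //; move: ip.
  by rewrite mem_iota add1n ltnS.
by rewrite mem_iota add1n ltnS.
Qed.

Lemma uniq_band_points v : -2 < v < 2 -> uniq (band_points v).
Proof.
move=> v2; rewrite map_inj_in_uniq ?iota_uniq// => i j.
rewrite !mem_iota add1n !ltnS => /andP[i1 ip] /andP[j1 jp] E.
have [ij|ji|//] := ltngtP i j.
- by have := band_points_lt i j v i1 ij jp v2; rewrite E ltxx.
- by have := band_points_lt j i v j1 ji ip v2; rewrite E ltxx.
Qed.

Lemma band_points_roots v : -2 < v < 2 ->
  size (D - v%:P) = (size (band_points v)).+1 /\ all (root (D - v%:P)) (band_points v).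
Proof.
move=> v2; rewrite size_map size_iota; split.
  by rewrite size_polyDl size_D// size_polyN (leq_ltn_trans (size_polyC_leq1 _)).
apply/allP => r /mem_band_points[i ip ->].
have [_ Dv] := band_pointP i ip v ltac:(lra).
by rewrite rootE hornerD hornerN hornerC Dv subrr.
Qed.

(** The preimages of v in the p bands are p distinct roots of D - v, a polynomial
    of degree p. *)
Lemma disc_factor v x : -2 < v < 2 ->
  D.[x] - v = lead_coef D * \prod_(i < p) (x - band_point i.+1 v).
Proof.
move=> v2; have [sz rt] := band_points_roots v v2.
have := all_roots_prod_XsubC sz rt; rewrite uniq_rootsE => /(_ (uniq_band_points v v2)).
rewrite lead_coefDl; last by rewrite size_D size_polyN (leq_ltn_trans (size_polyC_leq1 _)).
move=> /(congr1 (fun f : {poly R} => f.[x])).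
rewrite hornerD hornerN hornerC hornerZ => ->; congr (_ * _).
rewrite horner_prod /band_points big_map -(big_mkord xpredT (fun i => x - band_point i.+1 v)).
rewrite -[1%N]addn0 iotaDl big_map /index_iota subn0.
by apply: eq_bigr => i _; rewrite hornerXsubC.
Qed.

Lemma complex_disc_roots v (z : R[i]) : -2 < v < 2 ->
  (map_poly (real_complex R) D).[z] = v%:C <->
  exists2 i, (1 <= i <= p)%N & z = (band_point i v)%:C.
Proof.
move=> v2; have [sz rt] := band_points_roots v v2.
have := complex_roots_prod (D - v%:P) (band_points v) sz rt (uniq_band_points v v2) z.
rewrite rmorphB/= map_polyC rootE hornerD hornerN hornerC subr_eq0 => -[H1 H2].
split=> [/eqP/H1[r /mem_band_points[i ip ->] ->]|[i ip zE]]; first by exists i.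
apply/eqP/H2; exists (band_point i v) => //.
by apply/mem_band_points; exists i.
Qed.

Lemma band_point_itv j v : (1 <= j <= p)%N -> -2 <= v <= 2 ->
  alpha j <= band_point j v <= beta j.
Proof. by move=> jp v2; have [] := band_pointP j jp v v2. Qed.

(** The j-th band is parametrized so that a uniform s gives D the arcsine
    distribution, whatever the direction in which D runs. *)
Definition branch j (s : R) : R := band_point j (arcsine_map s).

Lemma branch_itv j s : (1 <= j <= p)%N -> alpha j <= branch j s <= beta j.
Proof. by move=> jp; apply: band_point_itv => //; exact: arcsine_map_itv. Qed.

Lemma branch_gtE j t s : (1 <= j <= p)%N -> alpha j <= t <= beta j ->
  (t < branch j s) = (band_sign j * D.[t] < band_sign j * arcsine_map s).
Proof.
move=> jp tj; have [bj Dv] := band_pointP j jp _ (arcsine_map_itv s).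
by rewrite (band_ltE j jp t (branch j s))// Dv.
Qed.

Lemma measurable_branch_gt j t : (1 <= j <= p)%N ->
  measurable [set s : R | t < branch j s].
Proof.
move=> jp; have ab := band_lt j jp.
have [ta|ta] := ltP t (alpha j).
  rewrite (_ : [set s | _] = setT)//; apply/seteqP; split=> // s _ /=.
  by have := branch_itv j s jp; lra.
have [tb|tb] := leP t (beta j); last first.
  rewrite (_ : [set s | _] = set0)//; apply/seteqP; split=> // s /=.
  by have := branch_itv j s jp; lra.
have ms : measurable_fun setT (fun s => band_sign j * arcsine_map s).
  by apply: measurable_funM => //; exact: measurable_arcsine_map.
rewrite (_ : [set s | _] = setT `&`
  (fun s => band_sign j * arcsine_map s) @^-1` `]band_sign j * D.[t], +oo[%classic).
  by apply: ms => //; exact: measurable_itv.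
apply/seteqP; split => s /=; rewrite in_itv/= andbT branch_gtE ?ta//.
by case.
Qed.

Lemma measurable_branch j : (1 <= j <= p)%N -> measurable_fun setT (branch j).
Proof.
move=> jp mT; apply: (measurability _ (RGenOInfty.measurableE R)) => //.
move=> /= _ [_ [t ->] <-]; rewrite preimage_itvoy.
by apply: measurableI => //; exact: measurable_branch_gt.
Qed.

Let B := bands p alpha beta.

Lemma measurable_bands : measurable (B : set (measurableTypeR R)).
Proof.
apply: bigcup_measurable => j _; exact: measurable_itv.
Qed.

Lemma branch_bands j s : (1 <= j <= p)%N -> B (branch j s).
Proof. by move=> jp; exists j => //=; rewrite in_itv/= branch_itv. Qed.

Lemma bands_bounds t : B t -> alpha 1 <= t <= beta p.
Proof.
move=> [j /= /andP[j1 jp]]; rewrite in_itv/= => tj.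
have A : alpha 1 <= alpha j.
  have [j2|] := ltnP 1%N j; last first.
    by move=> j1'; rewrite (_ : j = 1%N)//; apply/eqP; rewrite eqn_leq j1 j1'.
  have := band_mono 1 j (leqnn _) j2 jp.
  by have := band_lt 1 p_gt0; lra.
have C : beta j <= beta p.
  have [jp'|] := ltnP j p; last first.
    by move=> pj; rewrite (_ : j = p)//; apply/eqP; rewrite eqn_leq jp pj.
  have := band_mono j p j1 jp' (leqnn _).
  by have := band_lt p ltac:(rewrite p_gt0 leqnn); lra.
lra.
Qed.

Lemma bands_disc t : B t -> -2 <= D.[t] <= 2.
Proof. by move=> [j /= jp]; rewrite in_itv/=; exact: band_disc_le. Qed.

(** Any number larger than the absolute values of all band edges would do. *)
Definition half_width : R := 1 + `|alpha 1| + `|beta p|.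

Lemma half_width_gt0 : 0 < half_width.
Proof. by rewrite /half_width -addrA ltr_pwDl// addr_ge0. Qed.

(** Rescaling that sends the bands into the interior of [-2, 2]; it is truncated so
    that the bound holds on the whole line. *)
Definition band_coord (s : measurableTypeR R) : R :=
  Num.max (-2) (Num.min 2 (s / half_width)).

Lemma measurable_band_coord : measurable_fun setT band_coord.
Proof.
apply: measurable_maxr => //; apply: measurable_minr => //.
exact: measurable_funM.
Qed.

Lemma band_coord_itv s : -2 <= band_coord s <= 2.
Proof.
by rewrite /band_coord le_max lexx/= ge_max ge_min lexx/= andbT; lra.
Qed.

Lemma band_width t : alpha 1 <= t <= beta p -> -1 < t / half_width < 1.
Proof.
move=> tB; have H0 := half_width_gt0.
rewrite ltr_pdivlMr// ltr_pdivrMr// /half_width.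
have := ler_norm (beta p); have := ler_norm (- alpha 1); rewrite normrN.
have := normr_ge0 (beta p); have := normr_ge0 (alpha 1); lra.
Qed.

Lemma band_coordE t : B t -> band_coord t = t / half_width.
Proof.
move=> /bands_bounds/band_width tB; rewrite /band_coord min_r; last by lra.
by rewrite max_r//; lra.
Qed.

Lemma sum_lne_norm (n : nat) (A : R) (y : nat -> R) : (0 < n)%N ->
  (\sum_(i < n) (A%:E - lne `|y i|%:E) =
    (n%:R * A)%:E - lne `|\prod_(i < n) y i|%:E)%E.
Proof.
case: n => // n _; elim: n => [|n IH]; first by rewrite !big_ord1 mul1r.
by rewrite big_ord_recr/= IH lne_normM [in RHS]big_ord_recr/= -[n.+2]addn1 natrD mulrDl mul1r.
Qed.

Let kappa : R := p%:R * (ln 8 + ln half_width) + ln `|lead_coef D| - ln 8.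

Lemma arcsine_map_interior (s : R) : 0 < s < 1 -> -2 < arcsine_map s < 2.
Proof.
move=> s01.
have c1 : cos (pi * s) != 1.
  apply/eqP; rewrite -cos0 => /cos_inj.
  rewrite !in_itv/= lexx pi_ge0 mulr_ge0 ?pi_ge0//=; last by lra.
  rewrite ger_pMr ?pi_gt0// => /(_ ltac:(lra) isT) /eqP.
  by rewrite mulf_eq0 gt_eqF ?pi_gt0//= => /eqP; lra.
have cN1 : cos (pi * s) != -1.
  apply/eqP; rewrite -cospi => /cos_inj.
  rewrite !in_itv/= lexx pi_ge0 mulr_ge0 ?pi_ge0//=; last by lra.
  rewrite ger_pMr ?pi_gt0// => /(_ ltac:(lra) isT) /eqP.
  rewrite -subr_eq0 -[X in _ - X]mulr1 -mulrBr mulf_eq0 gt_eqF ?pi_gt0//= => /eqP; lra.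
have := cos_le1 (pi * s); have := cos_geN1 (pi * s); rewrite /arcsine_map.
by move: c1 cN1; rewrite !neq_lt; lra.
Qed.

(** The logarithm of the factorization of D(x) - v over the bands. The value s in
    (0, 1) keeps v = 2 cos(pi s) away from -2 and 2, where two preimages may
    coincide at a closed gap. *)
Lemma sum_log_kernel_branches x s : B x -> 0 < s < 1 ->
  (\sum_(i < p) log_kernel (band_coord x) (band_coord (branch i.+1 s)) =
   log_kernel D.[x] (arcsine_map s) - (- kappa)%:E)%E.
Proof.
move=> Bx s01.
have H0 := half_width_gt0.
have v2 := arcsine_map_interior s s01.
have l0 : lead_coef D != 0 by rewrite lead_coef_eq0 -size_poly_eq0 size_D.
rewrite (eq_bigr (fun i : 'I_p => (ln 8 + ln half_width)%:E -
    lne `|x - branch (i : nat).+1 s|%:E)%E); last first.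
  move=> i _; apply: (@log_kernel_scale R B) => //.
    by move=> t; exact: band_coordE.
  by apply: branch_bands; rewrite ltn_ord.
rewrite (sum_lne_norm p _ (fun i => x - branch i.+1 s))//.
rewrite /log_kernel (disc_factor _ x v2) -[in RHS]/(branch _ s).
rewrite -[in LHS](_ : \prod_(i < p) (x - band_point i.+1 (arcsine_map s)) =
  \prod_(i < p) (x - branch i.+1 s))//.
move: (\prod_(i < p) _) => y.
rewrite !lne_norm_cases mulf_eq0 (negbTE l0)/=.
case: ifPn => [//|y0].
rewrite normrM lnM ?posrE ?normr_gt0// -!EFinB; congr EFin; rewrite /kappa; lra.
Qed.

Lemma exists_band_measure : exists mu0 : probability (measurableTypeR R) R,
  forall g : R -> \bar R, measurable_fun setT g -> (forall x, 0 <= g x)%E ->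
  (\int[mu0]_x g x =
    (p%:R^-1)%:E * \sum_(i < p) \int[unit_uniform]_s g (branch i.+1 s))%E.
Proof.
have [//|mu0 mu0P] := @average_distribution R _ _ unit_uniform p (fun i => branch i.+1) p_gt0.
  by move=> i ip; apply: measurable_branch; rewrite ip.
by exists mu0.
Qed.

Section BandMeasure.
Variable mu0 : probability (measurableTypeR R) R.
Hypothesis mu0P : forall g : R -> \bar R,
  measurable_fun setT g -> (forall x, 0 <= g x)%E ->
  (\int[mu0]_x g x =
    (p%:R^-1)%:E * \sum_(i < p) \int[unit_uniform]_s g (branch i.+1 s))%E.

Lemma band_measureE (A : set (measurableTypeR R)) : measurable A ->
  (mu0 A = (p%:R^-1)%:E * \sum_(i < p) @unit_uniform R (branch i.+1 @^-1` A))%E.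
Proof.
move=> mA; have := mu0P (fun x => (\1_A x)%:E).
rewrite integral_indic// setIT => ->; last 2 first.
- exact/measurable_EFinP/measurable_indic.
- by move=> x; rewrite lee_fin.
congr (_ * _)%E; apply: eq_bigr => i _.
have mbA : measurable (branch i.+1 @^-1` A).
  by rewrite -[X in measurable X]setTI; apply: measurable_branch; rewrite ?ltn_ord.
have := @integral_indic _ (measurableTypeR R) R unit_uniform setT measurableT _ mbA.
by rewrite setIT.
Qed.

Lemma band_measure_bands : mu0 B = 1%E.
Proof.
rewrite band_measureE; last exact: measurable_bands.
rewrite (eq_bigr (fun=> 1%E)); last first.
  move=> i _; rewrite (_ : _ @^-1` _ = setT) ?probability_setT//.
  by apply/seteqP; split=> // s _; apply: branch_bands; rewrite ltn_ord.
rewrite sumEFin big_const_ord iter_addr addr0 -EFinM -[(1 *+ p)%R]/(p%:R)%R mulVf//.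
by rewrite pnatr_eq0 -lt0n.
Qed.

Let X := band_coord.
Let X2 := band_coord_itv.
Let mX := measurable_band_coord.

(** Summing over the branches reduces the potential at x to the potential of the
    arcsine distribution at D(x), which does not depend on x. *)
Lemma band_potential (x : measurableTypeR R) : B x ->
  (\int[mu0]_t log_kernel (X x) (X t) = (p%:R^-1 * (ln 8 + kappa))%:E)%E.
Proof.
move=> Bx.
have mK : measurable_fun setT (fun t : measurableTypeR R => log_kernel (X x) (X t)).
  have mK2 := measurable_log_kernel X X mX mX X2 X2.
  exact: measurableT_comp mK2 (pair1_measurable x).
have D2 := bands_disc x Bx.
have K0 (t : R) : (0 <= log_kernel (X x) (X t))%E by exact: log_kernel_ge0.
have mKi (i : 'I_p) : measurable_fun setT (fun s => log_kernel (X x) (X (branch i.+1 s))).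
  by apply: (measurableT_comp mK); apply: measurable_branch; rewrite ltn_ord.
have mL : measurable_fun setT (fun s : R => log_kernel D.[x] (arcsine_map s)).
  have mL2 := @measurable_log_kernel R _ (measurableTypeR R) _ (measurableTypeR R)
    (fun=> D.[x]) (@arcsine_map R)
    (measurable_cst _) measurable_arcsine_map (fun=> D2) arcsine_map_itv.
  exact: measurableT_comp mL2 (pair1_measurable (0 : measurableTypeR R)).
rewrite mu0P// EFinM; congr (_ * _)%E.
rewrite -ge0_integral_sum//.
rewrite (@prob_eq_integral _ _ _ unit_uniform `]0, 1[%classic _
    (fun s => log_kernel D.[x] (arcsine_map s) - (- kappa)%:E)%E).
- rewrite integral_subr_cst//; last first.
    by move=> s; apply: log_kernel_ge0 => //; exact: arcsine_map_itv.
  by rewrite arcsine_potential// -EFinB opprK.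
- exact: measurable_itv.
- rewrite unit_uniformE; last exact: measurable_itv.
  rewrite setIidl; last by apply: subset_itv; rewrite bnd_simp.
  by rewrite lebesgue_measure_itv/= lte_fin ltr01 -EFinB subr0.
- by apply: emeasurable_sum => i; exact: mKi.
- by apply: emeasurable_funB.
- by move=> s /=; rewrite in_itv/= => s01; exact: sum_log_kernel_branches.
Qed.

End BandMeasure.

(** Let I denote the mutual energy and mu0 the band measure. The potential of mu0
    is a constant C on the bands, so I(dk, mu0) = I(mu0, mu0) = C, while
    I(dk, dk) <= I(mu0, mu0) by minimality. Hence the energy of dk - mu0 is
    nonpositive, so dk and mu0 have the same moments and are equal. *)
Lemma equilibrium_distribution (dk mu0 : probability (measurableTypeR R) R) :
  is_equilibrium_measure B dk ->
  (forall g : R -> \bar R, measurable_fun setT g -> (forall x, 0 <= g x)%E ->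
    (\int[mu0]_x g x =
    (p%:R^-1)%:E * \sum_(i < p) \int[unit_uniform]_s g (branch i.+1 s))%E) ->
  forall c, -2 <= c <= 2 ->
  dk [set s | c < band_coord s] = mu0 [set s | c < band_coord s].
Proof.
move=> [dkB dkmin] mu0P.
have mX := measurable_band_coord; have X2 := band_coord_itv.
have mu0B := band_measure_bands mu0 mu0P.
have mB := measurable_bands.
set C := (p%:R^-1 * (ln 8 + kappa))%R.
have EC (nu : probability (measurableTypeR R) R) : nu B = 1%E -> energy band_coord nu mu0 = C%:E.
  move=> nuB; rewrite /energy.
  rewrite (@prob_eq_integral _ _ _ nu B _ (cst C%:E))//.
  - by rewrite integral_cst// measure_setT mule1.
  - exact: measurable_log_potential.
  - by move=> x Bx; rewrite band_potential.
have E1 := EC dk dkB; have E2 := EC mu0 mu0B.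
have := dkmin mu0 mu0B.
rewrite (log_energyE B band_coord half_width mB half_width_gt0 mX X2 band_coordE dk dkB).
rewrite (log_energyE B band_coord half_width mB half_width_gt0 mX X2 band_coordE mu0 mu0B).
rewrite E2 leeD2rE// => Edk.
have Sep : forall n, cheb_moment dk band_coord n = cheb_moment mu0 band_coord n.
  apply: energy_separates => //; first by rewrite E1 ltry.
  by rewrite E1 E2 leeD.
by move=> c c2; apply: moment_distribution_eq.
Qed.

Lemma measurable_gt_set (t : R) : measurable ([set s | t < s] : set (measurableTypeR R)).
Proof.
rewrite (_ : [set s | _] = `]t, +oo[%classic); first exact: measurable_itv.
by apply/seteqP; split => s /=; rewrite in_itv/= andbT.
Qed.

Lemma unit_uniform_eq1 (A : set (measurableTypeR R)) : measurable A ->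
  (forall s, 0 < s < 1 -> A s) -> @unit_uniform R A = 1%E.
Proof.
move=> mA A01; apply/eqP; rewrite eq_le probability_le1//=.
rewrite unit_uniformE//.
apply: (@le_trans _ _ (lebesgue_measure (`]0%R, 1%R[%classic : set R))).
  by rewrite lebesgue_measure_itv/= lte_fin ltr01 -EFinB subr0.
apply: le_measure; rewrite ?inE.
- exact: measurable_itv.
- by apply: measurableI => //; exact: measurable_itv.
- move=> s /=; rewrite !in_itv/= => s01; split; first exact: A01.
  by lra.
Qed.

Lemma unit_uniform_itv (A : set (measurableTypeR R)) (i : interval R) (r : R) :
  measurable A -> A `&` `[0, 1] = [set` i] ->
  lebesgue_measure ([set` i] : set R) = r%:E -> @unit_uniform R A = r%:E.
Proof. by move=> mA AE <-; rewrite unit_uniformE// AE. Qed.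

(** The sign in the hypothesis makes G increase from 0 to 1 along the band in both
    orientations. *)
Lemma unit_uniform_branch_gt j t G : (1 <= j <= p)%N -> alpha j <= t <= beta j ->
  0 <= G <= 1 -> D.[t] = - (band_sign j * (2 * cos (pi * G))) ->
  @unit_uniform R [set s | t < branch j s] = (1 - G)%:E.
Proof.
move=> jp tj G01 Dt; have mA := measurable_branch_gt j t jp.
have [S _] := band_signP j jp.
have pi0 := pi_gt0 R.
have piu (u : R) : 0 <= u <= 1 -> 0 <= pi * u <= pi.
  by move=> /andP[u0 u1]; rewrite mulr_ge0 ?(ltW pi0)//= ger_pMr.
have cosE (u v : R) : 0 <= u <= 1 -> 0 <= v <= 1 ->
    (cos (pi * u) < cos (pi * v)) = (v < u).
  by move=> u01 v01; rewrite ltr_cos ?in_itv/= ?piu// ltr_pM2l.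
have cosC (u : R) : cos (pi * (1 - u)) = - cos (pi * u).
  by rewrite mulrBr mulr1 cosB cospi sinpi; ring.
case: S => S.
  apply: (@unit_uniform_itv _ `[0, 1 - G[ _ mA).
    apply/seteqP; split => s /=; rewrite !in_itv/=.
      move=> [H1 s01]; move: H1; rewrite branch_gtE// Dt S /arcsine_map => H1.
      have : cos (pi * (1 - G)) < cos (pi * s) by rewrite cosC; lra.
      by rewrite cosE; lra.
    move=> s01; split; last by lra.
    rewrite branch_gtE// Dt S /arcsine_map.
    have : cos (pi * (1 - G)) < cos (pi * s) by rewrite cosE; lra.
    by rewrite cosC; lra.
  rewrite lebesgue_measure_itv/= lte_fin; case: ifPn; first by rewrite -EFinB subr0.
  by rewrite -leNgt => G1; congr EFin; lra.
apply: (@unit_uniform_itv _ `]G, 1] _ mA).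
  apply/seteqP; split => s /=; rewrite !in_itv/=.
    move=> [H1 s01]; move: H1; rewrite branch_gtE// Dt S /arcsine_map => H1.
    have : cos (pi * s) < cos (pi * G) by lra.
    by rewrite cosE; lra.
  move=> s01; split; last by lra.
  rewrite branch_gtE// Dt S /arcsine_map.
  have : cos (pi * s) < cos (pi * G) by rewrite cosE; lra.
  by lra.
rewrite lebesgue_measure_itv/= lte_fin; case: ifPn; first by rewrite -EFinB.
by rewrite -leNgt => G1; congr EFin; lra.
Qed.

Lemma sum_indicator_gt (n j : nat) : (\sum_(i < n) (j <= i)%N = n - j)%N.
Proof.
elim: n => [|n IH]; first by rewrite big_ord0.
rewrite big_ord_recr/= IH; case: leqP => /= h; lia.
Qed.

(** The bands to the right of the j-th one contribute 1/p each, the j-th one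
    contributes (1 - G)/p. *)
Lemma band_measure_gt (mu0 : probability (measurableTypeR R) R) j t G :
  (forall g : R -> \bar R, measurable_fun setT g -> (forall x, 0 <= g x)%E ->
    (\int[mu0]_x g x =
    (p%:R^-1)%:E * \sum_(i < p) \int[unit_uniform]_s g (branch i.+1 s))%E) ->
  (1 <= j <= p)%N -> alpha j <= t <= beta j ->
  0 <= G <= 1 -> D.[t] = - (band_sign j * (2 * cos (pi * G))) ->
  mu0 [set s | t < s] = (1 - (j%:R - 1 + G) / p%:R)%:E.
Proof.
move=> mu0P jp tj G01 Dt; have /andP[j1 jp'] := jp.
rewrite (band_measureE mu0 mu0P); last exact: measurable_gt_set.
rewrite (eq_bigr (fun i : 'I_p => ((j <= i)%:R + (i == j.-1 :> nat)%:R * (1 - G))%:E)); last first.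
  move=> i _; have ip : (1 <= i.+1 <= p)%N by rewrite ltn_ord.
  have -> : branch i.+1 @^-1` [set s | t < s] = [set s | t < branch i.+1 s] by [].
  have [ij|ij|E] := ltngtP i.+1 j.
  - rewrite (_ : [set s | _] = set0).
      rewrite measure0 leqNgt (ltnW ij) (_ : (_ == _) = false)//=; last by lia.
      by rewrite mul0r addr0.
    apply/seteqP; split=> // s /=.
    by have := branch_itv i.+1 s ip; have := band_mono i.+1 j isT ij jp'; lra.
  - rewrite unit_uniform_eq1.
    + rewrite -ltnS ij (_ : (_ == _) = false)//=; last by lia.
      by rewrite mul0r addr0.
    + exact: measurable_branch_gt.
    + move=> s s01 /=.
      have v2 : -2 < arcsine_map s < 2 by exact: arcsine_map_interior.
      have := band_point_interior i.+1 ip _ v2; rewrite -/(branch i.+1 s).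
      by have := band_mono j i.+1 j1 ij (ltn_ord i); lra.
  - rewrite -E in jp tj Dt *.
    rewrite (unit_uniform_branch_gt _ _ G)// ltnn eqxx /=.
    by rewrite add0r mul1r.
rewrite sumEFin -EFinM; congr EFin.
rewrite big_split/= -natr_sum sum_indicator_gt -mulr_suml -natr_sum.
(* Bands are numbered from 1 and branches from 0, hence the index j - 1. *)
have -> : (\sum_(i < p) (i == j.-1 :> nat) = 1)%N.
  have jp1 : (j.-1 < p)%N by rewrite prednK.
  rewrite (bigD1 (Ordinal jp1))//= eqxx big1 ?addn0// => i.
  by rewrite -val_eqE/= => /negbTE->.
have p0 : (p%:R : R) != 0 by rewrite pnatr_eq0 -lt0n.
rewrite natrB//; field; exact: p0.
Qed.

Section EquilibriumDistribution.
Variable dk : probability (measurableTypeR R) R.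
Hypothesis equilibrium : is_equilibrium_measure B dk.

Local Notation k := (integrated_from dk (alpha 1)).

Lemma equilibrium_cdf j t G :
  (1 <= j <= p)%N -> alpha j <= t <= beta j ->
  0 <= G <= 1 -> D.[t] = - (band_sign j * (2 * cos (pi * G))) ->
  k t = (j%:R - 1 + G) / p%:R.
Proof.
move=> jp tj G01 Dt.
have [mu0 mu0P] := exists_band_measure.
have tB : B t by exists j => //=; rewrite in_itv.
have t01 := band_width t (bands_bounds t tB).
have H0 := half_width_gt0.
(* The truncation is invisible here since |t / half_width| < 1. *)
have gtE : [set s | t / half_width < band_coord s] = [set s | t < s].
  apply/seteqP; split => s /=; rewrite /band_coord lt_max lt_min.
    by rewrite ltr_pM2r ?invr_gt0//; case/orP => [|/andP[]//]; lra.
  by rewrite ltr_pM2r ?invr_gt0// => ->; rewrite andbT; apply/orP; right; lra.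
have := equilibrium_distribution dk mu0 equilibrium mu0P (t / half_width) ltac:(lra).
rewrite gtE (band_measure_gt mu0 j t G mu0P jp tj G01 Dt) => dkt.
have mI : measurable (`[alpha 1, t]%classic : set (measurableTypeR R)) by exact: measurable_itv.
have mG := measurable_gt_set t.
have [dkB _] := equilibrium.
have U1 : dk (`[alpha 1, t]%classic `|` [set s | t < s]) = 1%E.
  apply/eqP; rewrite eq_le probability_le1/=; last exact: measurableU.
  rewrite -dkB; apply: le_measure; rewrite ?inE.
  - exact: measurable_bands.
  - exact: measurableU.
  - move=> s /bands_bounds s1; have [st|ts] := leP s t; last by right.
    by left; rewrite /= in_itv/=; lra.
have H : (1%E = dk `[alpha 1, t]%classic + dk [set s | (t < s)%R])%E.
  rewrite -U1; apply: measureU => //.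
  by apply/seteqP; split => // s /= []; rewrite in_itv/=; lra.
have fI := @fin_num_measure _ _ _ dk _ mI.
rewrite dkt in H; rewrite /integrated_from.
move: H fI; case: (dk `[alpha 1, t]%classic) => // r [] H _ /=; lra.
Qed.

Lemma integrated_from_mono s t : s <= t -> k s <= k t.
Proof.
move=> st; rewrite /integrated_from fine_le ?fin_num_measure//.
apply: le_measure; rewrite ?inE; try exact: measurable_itv.
by move=> u /=; rewrite !in_itv/=; lra.
Qed.

(** A level strictly between (i-1)/p and i/p is attained neither at the left of the
    i-th band nor at its right, by monotonicity of k and its values at the edges. *)
Lemma equilibrium_cdf_level i (r t : R) : (1 <= i <= p)%N -> 0 < r < 1 ->
  k t = (i%:R - 1 + r) / p%:R <->
  t = band_point i (- (band_sign i * (2 * cos (pi * r)))).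
Proof.
move=> ip r01; have ab := band_lt i ip.
have [S [Sb Sa]] := band_signP i ip.
have p0 : 0 < (p%:R : R) by rewrite ltr0n.
have v2 : -2 <= - (band_sign i * (2 * cos (pi * r))) <= 2.
  by have := cos_le1 (pi * r); have := cos_geN1 (pi * r); case: S => ->; lra.
have [bi Dv] := band_pointP i ip _ v2.
split=> [kt|->]; last by rewrite (equilibrium_cdf i _ r)//; lra.
have ka : k (alpha i) = (i%:R - 1 + 0) / p%:R.
  by apply: equilibrium_cdf => //; rewrite ?mulr0 ?cos0 ?Sa; lra.
have kb : k (beta i) = (i%:R - 1 + 1) / p%:R.
  by apply: equilibrium_cdf => //; rewrite ?mulr1 ?cospi ?Sb; lra.
have ti : alpha i < t < beta i.
  apply/andP; split; rewrite ltNge; apply/negP => /integrated_from_mono.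
    by rewrite kt ka ler_pM2r ?invr_gt0//; lra.
  by rewrite kt kb ler_pM2r ?invr_gt0//; lra.
have ti' : alpha i <= t <= beta i by lra.
have Dt2 := band_disc_le i ip t ti'.
(* The fraction of the band to the left of t; it must be equal to r. *)
pose G := acos (- (band_sign i * D.[t] / 2)) / pi.
have pi0 := pi_gt0 R.
have w2 : -1 <= - (band_sign i * D.[t] / 2) <= 1 by case: S => ->; lra.
have cG : cos (pi * G) = - (band_sign i * D.[t] / 2).
  by rewrite /G mulrC divfK ?gt_eqF// acosK// in_itv.
have G01 : 0 <= G <= 1.
  apply/andP; split; first by rewrite /G divr_ge0 ?acos_ge0 ?(ltW pi0).
  by rewrite /G ler_pdivrMr// mul1r acos_lepi.
have DG : D.[t] = - (band_sign i * (2 * cos (pi * G))).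
  by rewrite cG; case: S => ->; lra.
have pV0 : (p%:R^-1 : R) != 0 by rewrite invr_eq0 gt_eqF.
have := equilibrium_cdf i t G ip ti' G01 DG; rewrite kt => /(mulIf pV0) E.
have rG : r = G by lra.
by rewrite rG; apply: band_point_unique => //.
Qed.

End EquilibriumDistribution.

End Bands.

(** * Zeros *)

Section ChebyshevRoots.
Context {R : realType}.

Lemma chebU_sin m (u : R) : (chebU m).[2 * cos u] * sin u = sin (m%:R * u).
Proof.
suff [] : (chebU m).[2 * cos u] * sin u = sin (m%:R * u) /\
  (chebU m.+1).[2 * cos u] * sin u = sin (m.+1%:R * u) by [].
elim: m => [|m [IH1 IH2]].
  by rewrite !hornerC !mul0r sin0 !mul1r.
split=> //; rewrite chebUSS hornerD hornerN hornerM hornerX mulrBl -mulrA IH1 IH2.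
have -> : m.+2%:R * u = m.+1%:R * u + u by rewrite -[m.+2]addn1 natrD; ring.
have -> : m%:R * u = m.+1%:R * u - u by rewrite -[m.+1]addn1 natrD; ring.
rewrite sinB sinD; ring.
Qed.

Lemma size_chebU m : size (chebU m : {poly R}) = m.
Proof.
suff [] : size (chebU m : {poly R}) = m /\ size (chebU m.+1 : {poly R}) = m.+1 by [].
elim: m => [|m [IH1 IH2]]; first by rewrite size_poly0 size_poly1.
split=> //; rewrite chebUSS mulrC.
by rewrite size_polyDl size_mulX ?size_polyN ?IH1 ?IH2// -size_poly_eq0 IH2.
Qed.

(** The numbers 2 cos(pi q/m) are m - 1 distinct zeros of sin(m u)/sin u, a
    polynomial of degree m - 1 in 2 cos u. *)
Lemma chebU_roots m (z : R[i]) : (0 < m)%N ->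
  root (map_poly (real_complex R) (chebU m)) z <->
  exists2 q, (1 <= q <= m.-1)%N & z = (2 * cos (pi * (q%:R / m%:R)))%:C.
Proof.
move=> m0; pose rs := [seq 2 * cos (pi * (q%:R / m%:R)) | q <- iota 1 m.-1] : seq R.
have mR : 0 < (m%:R : R) by rewrite ltr0n.
have pi0 := pi_gt0 R.
have memq q : (q \in iota 1 m.-1) = (1 <= q <= m.-1)%N.
  by rewrite mem_iota add1n ltnS.
have q01 q : (1 <= q <= m.-1)%N -> 0 < (q%:R / m%:R : R) < 1.
  by move=> q1; rewrite divr_gt0 ?ltr0n//= ?ltr_pdivrMr ?mul1r ?ltr_nat//; lia.
have piq q : (1 <= q <= m.-1)%N -> 0 < pi * (q%:R / m%:R : R) < pi.
  by move=> /q01/andP[q0 q1]; rewrite mulr_gt0//= gtr_pMr.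
rewrite (complex_roots_prod _ rs).
- split=> [[r /mapP[q]]|[q q1 ->]]; first by rewrite memq => q1 -> ->; exists q.
  by exists (2 * cos (pi * (q%:R / m%:R))) => //; apply/mapP; exists q => //; rewrite memq.
- by rewrite size_chebU size_map size_iota prednK.
- apply/allP => r /mapP[q]; rewrite memq => q1 ->; apply/rootP.
  have s0 : sin (pi * (q%:R / m%:R) : R) != 0 by rewrite gt_eqF// sin_gt0_pi// piq.
  apply: (mulIf s0); rewrite chebU_sin mul0r.
  have -> : m%:R * (pi * (q%:R / m%:R)) = q%:R * pi :> R.
    by field; exact: lt0r_neq0.
  exact: sin_natpi.
- rewrite map_inj_in_uniq ?iota_uniq// => q1 q2; rewrite !memq => h1 h2.
  have two0 : (2 : R) != 0 by rewrite pnatr_eq0.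
  move=> /(mulfI two0)/cos_inj; rewrite !in_itv/=.
  have /andP[a1 b1] := piq q1 h1; have /andP[a2 b2] := piq q2 h2.
  rewrite !ltW// => /(_ isT isT) /(mulfI (lt0r_neq0 pi0)).
  have mV0 : (m%:R^-1 : R) != 0 by rewrite invr_eq0 lt0r_neq0.
  by move=> /(mulIf mV0)/eqP; rewrite eqr_nat => /eqP.
Qed.

End ChebyshevRoots.

Theorem theorem2p1 (R : realType) (p : nat) (a b : nat -> R)
  (alpha beta x : nat -> R) (dk : probability (measurableTypeR R) R)
  (p_ge1 : (1 <= p)%N)
  (jacobi_ab : periodic_jacobi p a b)
  (edges : band_edges p a b alpha beta)
  (dirichlet_x : dirichlet_data p a b alpha beta x)
  (equilibrium_dk : is_equilibrium_measure (bands p alpha beta) dk)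
  (m : nat) (m_ge1 : (1 <= m)%N) :
  let k := integrated_from dk (alpha 1%N) in
  exists y : nat -> nat -> R,
    (forall i q : nat, (1 <= i <= p)%N -> (1 <= q <= m.-1)%N ->
       forall t : R,
         k t = (i%:R - 1) / p%:R + q%:R / (m * p)%:R <-> t = y i q) /\
    (forall z : R[i],
       root (map_poly (real_complex R)
               (monic_orthogonal_poly a b (m * p).-1)) z <->
       (exists2 j : nat, (1 <= j <= p.-1)%N & z = (x j)%:C) \/
       (exists i q : nat,
          [/\ (1 <= i <= p)%N, (1 <= q <= m.-1)%N & z = (y i q)%:C])).
Proof.
move=> k.
have [a_gt0 a_per b_per a_0] := jacobi_ab.
have [band_lt gap_le bandsP] := edges.
have [dirP dir_gap] := dirichlet_x.
set D := discriminant p a b in bandsP.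
have size_D : size D = p.+1 by exact: size_discriminant.
(* The value of D at the fraction q/m of the i-th band, counted from the left; up
   to sign it is a root of chebU m, and exchanging q and m - q changes the sign. *)
pose v i q : R := - (band_sign D beta i * (2 * cos (pi * (q%:R / m%:R)))).
have mR : 0 < (m%:R : R) by rewrite ltr0n.
have pR : 0 < (p%:R : R) by rewrite ltr0n.
have q01 q : (1 <= q <= m.-1)%N -> 0 < (q%:R / m%:R : R) < 1.
  by move=> q1; rewrite divr_gt0 ?ltr0n//= ?ltr_pdivrMr ?mul1r ?ltr_nat//; lia.
exists (fun i q => band_point D alpha beta i (v i q)); split.
  move=> i q ip q1 t.
  rewrite (_ : _ + _ = (i%:R - 1 + q%:R / m%:R) / p%:R); last first.
    rewrite natrM; field.
    by apply/andP; split; exact: lt0r_neq0.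
  apply: (equilibrium_cdf_level p D alpha beta) => //; exact: q01.
move=> z.
have l0 : lead_coef (orthonormal_poly a b (m * p).-1) != 0.
  by rewrite lead_coef_eq0 -size_poly_eq0 size_orthonormal_poly.
rewrite /monic_orthogonal_poly map_polyZ rootZ ?fmorph_eq0 ?invr_eq0//=.
rewrite (orthonormal_poly_factor _ _ a_gt0 p)// rmorphM/= map_comp_poly rootM root_comp.
(* Consecutive Dirichlet points are separated by a band. *)
have dir_lt i j : (1 <= i)%N -> (i < j)%N -> (j <= p.-1)%N -> x i < x j.
  move=> i1 ij jp.
  have := dir_gap i ltac:(lia); have := dir_gap j ltac:(lia).
  have := band_lt j ltac:(lia).
  have [ij1|ij1] : (i.+1 = j \/ i.+1 < j)%N by lia.
    by rewrite ij1; lra.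
  have := band_lt i.+1 ltac:(lia).
  by have := band_mono p alpha beta band_lt gap_le i.+1 j isT ij1 ltac:(lia); lra.
have dir_roots : root (map_poly (real_complex R) (orthonormal_poly a b p.-1)) z <->
    exists2 j : nat, (1 <= j <= p.-1)%N & z = (x j)%:C.
  have memj j : (j \in iota 1 p.-1) = (1 <= j <= p.-1)%N.
    by rewrite mem_iota add1n ltnS.
  rewrite (complex_roots_prod _ [seq x j | j <- iota 1 p.-1]).
  - split=> [[r /mapP[j]]|[j jp ->]]; first by rewrite memj => jp -> ->; exists j.
    by exists (x j) => //; apply/mapP; exists j => //; rewrite memj.
  - by rewrite size_map size_iota size_orthonormal_poly.
  - apply/allP => r /mapP[j]; rewrite memj => jp ->.
    by apply/(dirichletP a b a_gt0 p p_ge1)/dirP; exists j.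
  - rewrite map_inj_in_uniq ?iota_uniq// => i j; rewrite !memj => /andP[i1 ip] /andP[j1 jp] E.
    have [ij|ji|//] := ltngtP i j.
    + by have := dir_lt i j i1 ij jp; rewrite E ltxx.
    + by have := dir_lt j i j1 ji ip; rewrite E ltxx.
have cos_rev q : (1 <= q <= m.-1)%N ->
    cos (pi * ((m - q)%:R / m%:R)) = - cos (pi * (q%:R / m%:R)) :> R.
  move=> q1; rewrite natrB; last by lia.
  rewrite mulrBl divff ?lt0r_neq0// mulrBr mulr1 cosB cospi sinpi; ring.
have c2 q : (1 <= q <= m.-1)%N -> -2 < (2 * cos (pi * (q%:R / m%:R)) : R) < 2.
  by move=> /q01 /arcsine_map_interior.
have chebP : root (map_poly (real_complex R) (chebU m))
      (map_poly (real_complex R) D).[z] <->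
    exists i q : nat, [/\ (1 <= i <= p)%N, (1 <= q <= m.-1)%N &
      z = (band_point D alpha beta i (v i q))%:C].
  have disc_roots := complex_disc_roots p D alpha beta p_ge1 size_D band_lt gap_le bandsP.
  rewrite chebU_roots//; split=> [[q q1 Dz]|[i [q [ip q1 zE]]]].
    have [i ip zE] := (disc_roots _ z (c2 q q1)).1 Dz.
    have [[S|S] _] := band_signP p D alpha beta p_ge1 size_D band_lt gap_le bandsP i ip.
      exists i, (m - q)%N; split=> //; first by lia.
      by rewrite zE /v S mul1r cos_rev// mulrN opprK.
    by exists i, q; split=> //; rewrite zE /v S mulN1r opprK.
  have [[S|S] _] := band_signP p D alpha beta p_ge1 size_D band_lt gap_le bandsP i ip.
    exists (m - q)%N; first by lia.
    apply/(disc_roots _ z (c2 (m - q)%N ltac:(lia))); exists i => //.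
    by rewrite zE /v S mul1r cos_rev// mulrN.
  exists q => //; apply/(disc_roots _ z (c2 q q1)); exists i => //.
  by rewrite zE /v S mulN1r opprK.
split=> [/orP[/chebP|/dir_roots]|[/dir_roots|/chebP]] H; first by right.
- by left.
- by rewrite H orbT.
- by rewrite H.
Qed.
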